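(* Assume that the following two conditions hold. (i) The mapping $E\times U\ni(x,a)\mapsto \mathbb{P}^a(x,\cdot)$ is continuous in variation norm, i.e. whenever $a_k\to a$ in $U$ and $x_k\to x$ in $E$, then $\sup_{A\in\mathcal{E}}|\mathbb{P}^{a_k}(x_k,A)-\mathbb{P}^a(x,A)|\to 0$ as $k\to\infty$. (ii) For each $n\in\mathbb{N}$, each $x\in B_n$ and each open set $O\subset E$ with $O\cap B_n\neq\emptyset$ there is $m\in\mathbb{N}$ such that $\inf_{V_m}(\hat{\mathbb{P}}_n^{V_m})^m(x,O)>0$, the infimum being over all $m$-step adapted strategies $V_m$. Then for each $n\in\mathbb{N}$ there exist a function $w_n\in C(E)$ and a constant $\lambda_n\in\mathbb{R}$ such that $$e^{w_n(x)}=\inf_{a\in U}\left[e^{c_n(x,a)-\lambda_n}\int_E e^{w_n(y)}\,\tilde{\mathbb{P}}_n^a(x,dy)\right]\quad\text{for all }x\in E,$$ and $\sup_{x\in B_{n+1}}w_n(x)=0$.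
   Context: Setting. $(E,\rho)$ is a locally compact separable metric space with Borel $\sigma$-field $\mathcal{E}$; $b\in E$ is a fixed point, $\mathbb{N}$ is the set of positive integers, $B_n:=\{x\in E:\rho(b,x)\le n\}$ for $n\in\mathbb{N}$, and each $B_n$ is compact. $U$ is a nonempty compact metric space (set of control parameters). For $x\in E$, $a\in U$, $\mathbb{P}^a(x,\cdot)$ is a probability measure on $(E,\mathcal{E})$, and $(x,a)\mapsto\mathbb{P}^a(x,D)$ is Borel measurable for each $D\in\mathcal{E}$. The function $c:E\times U\to\mathbb{R}$ is continuous, bounded and not constant; $\bar c:=\sup_{x\in E,a\in U}c(x,a)$, $\underline c:=\inf_{x\in E,a\in U}c(x,a)$, and $\bar c\ge 0$. $C(E)$ is the space of bounded continuous real functions on $E$. Approximating objects. $\mu$ is a fixed probability measure on $E$ with support $D\subset B_1$. $\rho(x,B_n)$ is the distance from $x$ to $B_n$, $(\cdot)^+$ is the positive part, $s\wedge t=\min\{s,t\}$, $B_n^c=E\setminus B_n$. For $n\in\mathbb{N}$, $x\in E$, $a\in U$, $A\in\mathcal{E}$: $$\tilde{\mathbb{P}}_n^a(x,A)=(1-\rho(x,B_n))^+\mathbb{P}^a(x,A\cap B_n)+\mu(A)\left[\mathbb{P}^a(x,B_n^c)+(\rho(x,B_n)\wedge 1)(1-\mathbb{P}^a(x,B_n^c))\right],$$ $$c_n(x,a)=(1-\rho(x,B_n))^+c(x,a)+(\rho(x,B_n)\wedge 1)\,\underline c .$$ Strategies. The controlled Markov process $(X_i)$ lives on a filtered probability space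 with filtration $(F_i)$; a strategy is a sequence of $U$-valued controls $(a_0,a_1,\ldots)$ with $a_i$ being $F_i$-measurable, and under it, given $F_i$, the law of $X_{i+1}$ is $\mathbb{P}^{a_i}(X_i,\cdot)$. $V_m$ denotes the (finite) initial part of such a strategy that governs the first $m$ steps, and $(\hat{\mathbb{P}}_n^{V_m})^m(x,A)$ is the probability, starting from $X_0=x$ and using $V_m$, that $X_1,\ldots,X_m\in B_n$ and $X_m\in A$. *)

(* Defs.v *)
From HB Require Import structures.
From mathcomp Require Import all_boot all_order all_algebra.
From mathcomp Require Import all_classical all_reals all_analysis.

Set Implicit Arguments.
Unset Strict Implicit.
Unset Printing Implicit Defensive.

Import Order.TTheory GRing.Theory Num.Theory.
Import numFieldNormedType.Exports.

Local Open Scope classical_set_scope.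
Local Open Scope ring_scope.

(* The generated sigma-algebras of the library live on pointed types, so a
   nonempty metric space is taken to be a metric space with a base point. *)
#[short(type="pmetricType")]
HB.structure Definition PointedMetric (K : numDomainType) :=
  { M of Pointed M & Metric K M }.

Notation borel T := (g_sigma_algebraType (@open T)).

Definition separable (T : topologicalType) : Prop :=
  exists2 S : set T, countable S & dense S.

Section Balls.
Context {R : realType} {E : pmetricType R}.

Definition Bn (b : E) (n : nat) : set E := [set x | mdist b x <= n%:R].

Definition dist_to (x : E) (A : set E) : R := inf [set mdist x y | y in A].

Lemma measurable_Bn (b : E) (n : nat) : measurable (Bn b n : set (borel E)).
Proof.
rewrite -[Bn b n]setCK; apply: measurableC; apply: sub_sigma_algebra.
rewrite openE => x /= /negP; rewrite -ltNge => bx.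
rewrite /interior; apply/metricType_numDomainType.nbhs_mdistP.
exists (mdist b x - n%:R); first by rewrite /= subr_gt0.
move=> y /= xy; apply/negP; rewrite -ltNge.
have := metric_triangle b y x; rewrite (metric_sym y x) => h.
by rewrite -(ltrD2r (mdist x y)) (lt_le_trans _ h)// -ltrBrDl.
Qed.

(* On a separable metric space this is the smallest closed set of full
   measure. *)
Definition support_of (mu : {measure set (borel E) -> \bar R}) : set E :=
  [set x | forall O : set E, open O -> O x -> (0 < mu O)%E].

End Balls.

Section ControlledProcess.
Context {R : realType} {E U : pmetricType R}.
Variable P : R.-pker (borel (E * U)%type) ~> (borel E).

(* An m-step adapted strategy from the initial state x, together with the
   filtered probability space and the controlled process it governs.  Only
   cp_F i and cp_X i for i <= m, and cp_a i for i < m, are constrained.  The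
   last field says that P (X_i, a_i) is a version of the conditional law of
   X_(i+1) given F_i. *)
Record strategy (m : nat) (x : E) := Strategy {
  cp_disp : measure_display ;
  cp_Omega : measurableType cp_disp ;
  cp_Pr : probability cp_Omega R ;
  cp_F : nat -> set (set cp_Omega) ;
  cp_X : nat -> cp_Omega -> E ;
  cp_a : nat -> cp_Omega -> U ;
  cp_F_sigma : forall i, (i <= m)%N -> sigma_algebra setT (cp_F i) ;
  cp_F_measurable : forall i, (i <= m)%N -> cp_F i `<=` measurable ;
  cp_F_incr : forall i j, (i <= j <= m)%N -> cp_F i `<=` cp_F j ;
  cp_X_adapted : forall i (A : set (borel E)), (i <= m)%N ->
    measurable A -> cp_F i (cp_X i @^-1` A) ;
  cp_a_adapted : forall i (A : set (borel U)), (i < m)%N ->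
    measurable A -> cp_F i (cp_a i @^-1` A) ;
  cp_X0 : cp_Pr (cp_X 0%N @^-1` [set x]) = 1%E ;
  cp_transition : forall i (A : set (borel E)) (G : set cp_Omega), (i < m)%N ->
    measurable A -> cp_F i G ->
    cp_Pr (G `&` cp_X i.+1 @^-1` A) =
      (\int[cp_Pr]_(w in G) P (cp_X i w, cp_a i w) A)%E }.

Arguments cp_F {m x} s.
Arguments cp_X {m x} s.
Arguments cp_a {m x} s.

Definition Phat (b : E) (n m : nat) (x : E) (V : strategy m x) (A : set E)
    : \bar R :=
  cp_Pr V [set w | (forall i, (1 <= i <= m)%N -> Bn b n (cp_X V i w)) /\
                   A (cp_X V m w)].

Definition variation_continuous : Prop :=
  forall (x_ : nat -> E) (a_ : nat -> U) (x : E) (a : U),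
    x_ @ \oo --> x -> a_ @ \oo --> a ->
    (fun k => ereal_sup [set `|P (x_ k, a_ k) A - P (x, a) A|%E
                        | A in (measurable : set (set (borel E)))]) @ \oo
      --> 0%E.

End ControlledProcess.

Section Approximation.
Context {R : realType} {E U : pmetricType R}.
Variables (P : R.-pker (borel (E * U)%type) ~> (borel E)).
Variables (mu : probability (borel E) R) (b : E).

Definition Ptilde (n : nat) (x : E) (a : U) (A : set (borel E)) : \bar R :=
  ((Num.max (1 - dist_to x (Bn b n)) 0)%:E * P (x, a) (A `&` Bn b n)
   + mu A * (P (x, a) (~` Bn b n)
             + (Num.min (dist_to x (Bn b n)) 1)%:E
               * (1 - P (x, a) (~` Bn b n))))%E.

Definition cn (c : E * U -> R) (n : nat) (x : E) (a : U) : R :=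
  Num.max (1 - dist_to x (Bn b n)) 0 * c (x, a)
  + Num.min (dist_to x (Bn b n)) 1 * inf (range c).

Section PtildeMeasure.
Variables (n : nat) (x : E) (a : U).

Let dist_to_ge0 : 0 <= dist_to x (Bn b n).
Proof.
apply: lb_le_inf; first by exists (mdist x b), b; rewrite //= /Bn/= mdistxx.
by move=> _ [y _ <-]; exact: mdist_ge0.
Qed.

Let p := fine (P (x, a) (~` Bn b n)).

Let mBnC : measurable (~` Bn b n : set (borel E)).
Proof. by apply: measurableC; exact: measurable_Bn. Qed.

Let PC_le1 : (P (x, a) (~` Bn b n) <= 1)%E.
Proof.
rewrite -(prob_kernel (s := P) (x, a)); apply: le_measure => //;
  by rewrite inE.
Qed.

Let pE : (P (x, a) (~` Bn b n) = p%:E)%E.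
Proof.
rewrite fineK// ge0_fin_numE; last exact: measure_ge0.
exact: le_lt_trans PC_le1 (ltry _).
Qed.

Let k1 : 0 <= Num.max (1 - dist_to x (Bn b n)) 0.
Proof. by rewrite le_max lexx orbT. Qed.

Let k2 : 0 <= p + Num.min (dist_to x (Bn b n)) 1 * (1 - p).
Proof.
have p0 : 0 <= p by rewrite fine_ge0.
have p1 : p <= 1 by rewrite -lee_fin -pE.
by rewrite addr_ge0// mulr_ge0 ?subr_ge0// le_min dist_to_ge0 ler01.
Qed.

Let PtildeM : {measure set (borel E) -> \bar R} := measure_add
  (mscale (NngNum k1) (mrestr (P (x, a)) (measurable_Bn b n)))
  (mscale (NngNum k2) mu).

Let PtildeE : Ptilde n x a = PtildeM.
Proof.
apply/funext => A; rewrite /Ptilde pE (muleC (mu A)).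
by apply/esym; exact: measure_addE.
Qed.

Let Ptilde0 : Ptilde n x a set0 = 0%E.
Proof. by rewrite PtildeE measure0. Qed.

Let Ptilde_ge0 A : (0 <= Ptilde n x a A)%E.
Proof. by rewrite PtildeE measure_ge0. Qed.

Let Ptilde_sigma_additive : semi_sigma_additive (Ptilde n x a).
Proof. by rewrite PtildeE; exact: measure_semi_sigma_additive. Qed.

HB.instance Definition _ := isMeasure.Build _ _ _ (Ptilde n x a)
  Ptilde0 Ptilde_ge0 Ptilde_sigma_additive.

End PtildeMeasure.

End Approximation.

(* Main.v *)
(* A nonlinear Perron-Frobenius argument by vanishing discount.  The Bellman
   operator [T f x = inf_a e^(c_n(x,a)) int f dPtilde_n^a(x)] is monotone and
   homogeneous and only sees [f] on the compact set [K = B_n]; by continuity in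
   variation, uniform in the control, it maps bounded families to
   equicontinuous ones.  In logarithmic form, [S w = ln (T (e^w))] is
   nonexpansive, so [w |-> S (beta w)] is a [beta]-contraction, and its
   approximate fixed points [w] satisfy [(1 - beta) |w| <= C].  Normalized by
   [max_K w = 0], they yield approximate eigenfunctions [e^w] of [T]; as
   [beta -> 1], equicontinuity provides a uniform limit [f] on [K], with
   [T f = e^kappa f] and [max_K f = 1].

   Only the positivity of [f] uses irreducibility.  A nearly optimal Markov
   feedback taking finitely many values defines a strategy under which
   [f (X_i)], suitably discounted and killed outside [B_n], is almost a
   supermartingale, so that [f x] is bounded below by a positive multiple of the
   probability to be in [f > 1/2] after [m] steps without leaving [B_n]. *)
Require Import Defs.
From HB Require Import structures.
From mathcomp Require Import all_boot all_order all_algebra.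
From mathcomp Require Import all_classical all_reals all_analysis.
From mathcomp Require Import measurable_realfun ring lra.

Set Implicit Arguments.
Unset Strict Implicit.
Unset Printing Implicit Defensive.

Import Order.TTheory GRing.Theory Num.Theory.
Import numFieldNormedType.Exports.

Local Open Scope classical_set_scope.
Local Open Scope ring_scope.

(** * Integrals and kernels *)

Lemma le_restr_integral d (T : measurableType d) (R : realType)
    (m1 m2 : {measure set T -> \bar R}) (D : set T) (f : T -> \bar R) :
  measurable D -> (forall A, measurable A -> A `<=` D -> m1 A <= m2 A)%E ->
  (forall x, 0 <= f x)%E -> measurable_fun setT f ->
  (\int[m1]_(x in D) f x <= \int[m2]_(x in D) f x)%E.
Proof.
move=> mD m12 f0 mf.
have rE (m : {measure set T -> \bar R}) :
    (\int[m]_(x in D) f x = \int[mrestr m mD]_(x in D) f x)%E.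
  by apply: eq_measure_integral => A mA /setIidl AD; rewrite /= /mrestr AD.
rewrite (rE m1) (rE m2); apply: ge0_le_measure_integral => // A mA;
  rewrite /= /mrestr.
by apply: m12; [exact: measurableI|exact: subIsetr].
Qed.

(** In a Hahn decomposition of [p - q] only the positive set [A] can favour [p], and there the
    excess of the integral of [f] is at most [p A - q A], because [1 - f] has the larger integral
    under [p]. Hence the error is [v] itself, without a factor 2. *)
Lemma le_integral_variation d (T : measurableType d) (R : realType)
    (p q : probability T R) (v : R) (f : T -> R) :
  (forall A, measurable A -> p A <= q A + v%:E)%E ->
  (forall x, 0 <= f x <= 1) -> measurable_fun setT f ->
  (\int[p]_x (f x)%:E <= \int[q]_x (f x)%:E + v%:E)%E.
Proof.
move=> pqv f01 mf.
pose nu := cadd (charge_of_finite_measure p) (copp (charge_of_finite_measure q)).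
have [A [B [[mA posA] [mB negB] AB AB0]]] := Hahn_decomposition nu.
have f0 x : (0 <= (f x)%:E)%E by rewrite lee_fin; case/andP: (f01 x).
have g0 x : (0 <= (1 - f x)%:E)%E.
  by rewrite lee_fin subr_ge0; case/andP: (f01 x).
have mfE : measurable_fun setT (EFin \o f) by exact/measurable_EFinP.
have mgE : measurable_fun setT (fun x => (1 - f x)%:E).
  by apply/measurable_EFinP; apply: measurable_funB.
have split_int (m : probability T R) :
    (\int[m]_x (f x)%:E = \int[m]_(x in A) (f x)%:E + \int[m]_(x in B) (f x)%:E)%E.
  rewrite -AB ge0_integral_setU//; by rewrite ?AB//; apply/disj_setPS;
    rewrite AB0.
have compl (m : probability T R) :
    (\int[m]_(x in A) (f x)%:E + \int[m]_(x in A) (1 - f x)%:E = m A)%E.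
  rewrite -ge0_integralD//; try exact: measurable_funTS.
  under eq_integral do rewrite -EFinD subrKC.
  by rewrite integral_cst// mul1e.
have finE (m : probability T R) (S : set T) : measurable S -> m S \is a fin_num.
  by move=> mS; exact: fin_num_measure.
have HB : (\int[p]_(x in B) (f x)%:E <= \int[q]_(x in B) (f x)%:E)%E.
  apply: le_restr_integral => // S mS SB;
    have : (p S - q S <= 0)%E := negB S mS SB.
  by rewrite sube_le0// finE.
(* On the positive set of [p - q] the comparison is made on [1 - f]. *)
have HA : (\int[q]_(x in A) (1 - f x)%:E <= \int[p]_(x in A) (1 - f x)%:E)%E.
  apply: le_restr_integral => // S mS SA;
    have : (0 <= p S - q S)%E := posA S mS SA.
  by rewrite sube_ge0// finE.
have int_fin (m : probability T R) (g : T -> R) : (forall x, 0 <= (g x)%:E)%E ->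
    (forall x, (g x)%:E <= 1)%E -> measurable_fun setT (EFin \o g) ->
    (\int[m]_(x in A) (g x)%:E \is a fin_num)%E.
  move=> g0' g1 mg; rewrite ge0_fin_numE ?integral_ge0//.
  apply: (@le_lt_trans _ _ (m A)); last by rewrite ltey_eq finE.
  rewrite -[leRHS]mul1e -(integral_cst m mA); apply: ge0_le_integral => //.
  exact: measurable_funTS.
rewrite !split_int -addeA [X in (_ <= _ + X)%E]addeC addeA; apply: leeD => //.
have := compl p; have := compl q.
have f1 x : ((f x)%:E <= 1)%E by rewrite lee_fin; case/andP: (f01 x).
have g1 x : ((1 - f x)%:E <= 1)%E by rewrite lee_fin gerBl; case/andP: (f01 x).
have := pqv A mA.
move: (int_fin p f f0 f1 mfE) (int_fin q f f0 f1 mfE) (finE p A mA) (finE q A mA).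
move: (int_fin p _ g0 g1 mgE) (int_fin q _ g0 g1 mgE) HA.
move=> /fineK <- /fineK <- + /fineK <- /fineK <- /fineK <- /fineK <-.
rewrite -!EFinD !lee_fin => + + [] + [].
by lra.
Qed.

Section constant_kernel.
Context d d' (X : measurableType d) (Y : measurableType d') (R : realType).
Variable m : {finite_measure set Y -> \bar R}.

(** This makes composition and product of kernels available for plain measures; below, the source is
    always [unit]. *)
Definition kcst (_ : X) : {measure set Y -> \bar R} := m.

Let measurable_kcst U : measurable U -> measurable_fun setT (kcst ^~ U).
Proof. by move=> mU; exact: measurable_cst. Qed.

HB.instance Definition _ := isKernel.Build _ _ X Y R kcst measurable_kcst.

Let kcst_uub : measure_fam_uub kcst.
Proof.
exists (fine (m setT) + 1) => x; rewrite -[ltLHS]fineK ?fin_num_measure//.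
by rewrite lte_fin ltrDl.
Qed.

HB.instance Definition _ := Kernel_isFinite.Build _ _ X Y R kcst kcst_uub.

End constant_kernel.

Section kernel_pullback.
Context d d' d'' (X : measurableType d) (Y : measurableType d')
  (Z : measurableType d'') (R : realType).
Variables (k : R.-pker Y ~> Z) (g : X -> Y).

(** The measurability proof is an argument so that the kernel structures below can be attached to
    this constant. *)
Definition kpullback (mg : measurable_fun setT g) (x : X) :
  {measure set Z -> \bar R} := k (g x).

Hypothesis mg : measurable_fun setT g.

Let measurable_kpullback U : measurable U ->
  measurable_fun setT (kpullback mg ^~ U).
Proof. by move=> mU; exact: measurableT_comp (measurable_kernel k _ mU) mg. Qed.

HB.instance Definition _ := isKernel.Build _ _ X Z R (kpullback mg)
  measurable_kpullback.

Let kpullback_setT x : kpullback mg x setT = 1%E.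
Proof. exact: prob_kernel. Qed.

HB.instance Definition _ := Kernel_isProbability.Build _ _ X Z R (kpullback mg)
  kpullback_setT.

End kernel_pullback.

Lemma integral_mrestr d (T : measurableType d) (R : realType)
    (m : {measure set T -> \bar R}) (D : set T) (mD : measurable D)
    (f : T -> \bar R) :
  (forall x, 0 <= f x)%E -> measurable_fun setT f ->
  (\int[mrestr m mD]_x f x = \int[m]_(x in D) f x)%E.
Proof.
move=> f0 mf; rewrite [LHS](ge0_negligible_integral _ _ _ _ (N := ~` D))//.
- rewrite setTD setCK; apply: eq_measure_integral => A mA /setIidl AD.
  by rewrite /= /mrestr AD.
- exact: measurableC.
- by rewrite -[LHS]/(m (~` D `&` D)) setICl measure0.
Qed.

(** The hypothesis presents [m] as the composition of [k] with the restriction of [p] to [G], seen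
    as a kernel from [unit]; the formula is then integration against a composed kernel. *)
Lemma integral_disintegration d d' (W : measurableType d) (Y : measurableType d')
    (R : realType) (p : probability W R) (k : R.-pker W ~> Y) (G : set W)
    (mG : measurable G) (m : {measure set Y -> \bar R}) (f : Y -> \bar R) :
  (forall A, measurable A -> m A = \int[p]_(w in G) k w A)%E ->
  (forall y, 0 <= f y)%E -> measurable_fun setT f ->
  (\int[m]_y f y = \int[p]_(w in G) \int[k w]_y f y)%E.
Proof.
move=> mE f0 mf.
have pGoo : (p G < +oo)%E by rewrite ltey_eq fin_num_measure.
have restrE (g : W -> \bar R) : (forall w, 0 <= g w)%E ->
    measurable_fun setT g ->
    (\int[p]_(w in G) g w = \int[mfrestr mG pGoo]_w g w)%E.
  by move=> g0 mg; rewrite -integral_mrestr//; exact: eq_measure_integral.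
pose l := kcst (X := unit) (mfrestr mG pGoo).
have msnd : measurable_fun setT (@snd unit W) by exact: measurable_snd.
rewrite restrE.
- rewrite -(integral_kcomp l (kpullback k msnd) tt f0 mf).
  apply: eq_measure_integral => A mA _; rewrite mE// restrE//.
  exact: measurable_kernel.
- by move=> w; exact: integral_ge0.
- apply: measurable_fun_integral_kernel => // U mU; exact: measurable_kernel.
Qed.

(** The joint law of a point [w] drawn from [p] and a second one drawn from [k w]. It serves to add
    one transition to a probability space. *)
Lemma probability_extension d d' (W : measurableType d) (Y : measurableType d')
    (R : realType) (p : probability W R) (k : R.-pker W ~> Y) :
  exists q : probability (W * Y)%type R, forall G A,
    measurable G -> measurable A ->
    q (G `*` A) = (\int[p]_(w in G) k w A)%E.
Proof.
have msnd : measurable_fun setT (@snd unit W) by exact: measurable_snd.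
pose q := mkproduct (kcst (X := unit) p) (kpullback k msnd) tt.
have qE G A : measurable G -> measurable A ->
    q (G `*` A) = (\int[p]_(w in G) k w A)%E.
  move=> mG mA; rewrite /q /= /kproduct [RHS]integral_mkcond.
  apply: eq_integral => w _; rewrite patchE /= /kernel.intker_indic/=.
  case: ifPn => wG.
    transitivity (\int[k w]_z (\1_A z)%:E)%E;
      last by rewrite integral_indic// setIT.
    by apply: eq_integral => z _; rewrite !indicE in_setX wG.
  by apply: integral0_eq => z _; rewrite indicE in_setX (negbTE wG).
have qT : q setT = 1%E.
  rewrite -setXTT qE//; under eq_integral do rewrite prob_kernel.
  by rewrite integral_cst// mul1e; exact: probability_setT.
pose Qm := Measure_isProbability.Build _ _ _ q qT.
pose Q : probability _ _ := HB.pack (Measure.sort q) (Measure.class q) Qm.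
by exists Q.
Qed.

(** * Strategies given by Markov feedbacks *)

Lemma measurable_fun_generated d (T : measurableType d) (Y : pointedType)
    (G : set (set Y)) (f : T -> g_sigma_algebraType G) :
  (forall A, G A -> measurable (f @^-1` A)) -> measurable_fun setT f.
Proof.
move=> fG; apply: (measurability (rT := g_sigma_algebraType G) G erefl).
by move=> _ [B GB <-]; rewrite setTI; exact: fG.
Qed.

Lemma continuous_measurable_borel (R : realType) (E : ptopologicalType)
    (f : E -> R) :
  continuous f -> measurable_fun [set: borel E] f.
Proof.
move=> /continuousP cf; apply: (measurability _ (RGenOpens.measurableE _)).
move=> _ [_ [a [b ->]] <-]; rewrite setTI; apply: sub_sigma_algebra; apply: cf.
exact: interval_open.
Qed.

Arguments cp_F {R E U P m x} s.
Arguments cp_X {R E U P m x} s.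
Arguments cp_a {R E U P m x} s.

Section FeedbackStrategy.
Context {R : realType} {E U : pmetricType R}.
Variables (P : R.-pker (borel (E * U)%type) ~> (borel E)) (u : E -> U).
(** The source of [P] carries the Borel sets of the product topology, so the map into that space is
    the one required to be measurable; measurability of [u] follows. *)
Hypothesis measurable_graph : measurable_fun [set: borel E]
  ((fun x => (x, u x)) : borel E -> borel (E * U)%type).

Lemma measurable_feedback : measurable_fun [set: borel E] (u : borel E -> borel U).
Proof.
apply: measurable_fun_generated => O oO.
have : measurable ((snd @^-1` O) : set (borel (E * U)%type)).
  have oO' : open ((snd : E * U -> U) @^-1` O).
    by apply: open_comp => // x _; exact: cvg_snd.
  exact: sub_sigma_algebra.
by move=> /(measurable_graph measurableT); rewrite setTI.
Qed.

(** Induction on [m]: the sample space is multiplied by [E], and the new coordinate is drawn from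
    [P] at the last state and its feedback control. *)
Lemma feedback_strategy (m : nat) (x : E) :
  exists V : strategy P m x, forall i w, cp_a V i w = u (cp_X V i w).
Proof.
elim: m => [|m [V Va]].
  (* Zero steps: the state space itself, with the Dirac mass at [x]. *)
  unshelve eexists (@Strategy _ _ _ P 0 x _ (borel E) (\d_(x : borel E))
    (fun _ => measurable) (fun _ => id) (fun _ => u) _ _ _ _ _ _ _) => //.
  - by move=> i _; exact: sigma_algebra_measurable.
  - by move=> i _ A.
  - by move=> i j _ A.
  - by rewrite -[LHS]/((\1_[set x] x)%:E) indicE mem_set.
pose T := cp_Omega V.
have mX i : (i <= m)%N -> measurable_fun [set: T] (cp_X V i : T -> borel E).
  move=> im _ A mA; rewrite setTI.
  by apply: (cp_F_measurable im); exact: cp_X_adapted.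
have mg : measurable_fun [set: T] ((fun w => (cp_X V m w, u (cp_X V m w))) :
    T -> borel (E * U)%type).
  by apply: (measurableT_comp measurable_graph); exact: mX.
have [Q QE] := probability_extension (cp_Pr V) (kpullback P mg).
have Qfst G : measurable G -> Q (fst @^-1` G) = cp_Pr V G.
  move=> mG; rewrite (_ : fst @^-1` G = G `*` setT); last first.
    by apply/seteqP; split => [[? ?]|[? ?] []].
  rewrite QE//; under eq_integral do rewrite prob_kernel.
  by rewrite integral_cst// mul1e.
(* Up to time [m] process and filtration are pulled back along the first projection; afterwards the
   state is the new coordinate and the filtration is the full sigma-algebra. *)
pose X' i (w : T * borel E) : E := if (i <= m)%N then cp_X V i w.1 else w.2.
pose F' i : set (set (T * borel E)) := if (i <= m)%N then
  preimage_set_system setT fst (cp_F V i) else measurable.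
have F'm i : F' i `<=` measurable.
  rewrite /F'; case: ifPn => [im _ [A FA <-]|_ A//];
    rewrite setTI -[_ @^-1` _]setTI.
  by apply: measurable_fst => //; exact: (cp_F_measurable im).
have X'F i (A : set (borel E)) : measurable A -> F' i (X' i @^-1` A).
  move=> mA; rewrite /F' /X'; case: ifPn => im.
    by exists (cp_X V i @^-1` A); [exact: cp_X_adapted|rewrite setTI].
  by rewrite -[_ @^-1` _]setTI; exact: measurable_snd.
unshelve eexists (@Strategy _ _ _ P m.+1 x _ (T * borel E)%type Q
    F' X' (fun i w => u (X' i w)) _ _ _ _ _ _ _) => //.
- move=> i _; rewrite /F'; case: ifPn => im.
    by apply: sigma_algebra_preimage; exact: (cp_F_sigma V im).
  exact: sigma_algebra_measurable.
- move=> i j /andP[ij jm]; rewrite {2}/F'; case: ifPn => [jm'|_];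
    last exact: F'm.
  rewrite /F' (leq_trans ij jm') => _ [A FA <-]; exists A => //.
  by apply: (cp_F_incr _ FA); rewrite ij.
- by move=> i A _; exact: X'F.
- move=> i A _ mA; have := measurable_feedback measurableT mA.
  by rewrite setTI => /(X'F i).
- rewrite /X'/= -[LHS]/(Q (fst @^-1` (cp_X V 0%N @^-1` [set x]))) Qfst ?cp_X0//.
  rewrite -[_ @^-1` _]setTI; apply: mX => //.
  rewrite -[X in measurable X]setCK; apply: measurableC;
    apply: sub_sigma_algebra.
  apply: closed_openC; apply: accessible_closed_set1.
  by apply: hausdorff_accessible; exact: metric_hausdorff.
move=> i A G im mA; rewrite /F' -ltnS im => -[B FB <-]; rewrite setTI.
have mB : measurable B by exact: (cp_F_measurable _ FB).
have mPA : measurable_fun setT (fun w => P (cp_X V i w, u (cp_X V i w)) A).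
  apply: (measurableT_comp (measurable_kernel P _ mA)).
  by apply: (measurableT_comp measurable_graph); exact: mX.
have -> : (\int[Q]_(w in fst @^-1` B) P (X' i w, u (X' i w)) A =
    \int[cp_Pr V]_(w in B) P (cp_X V i w, u (cp_X V i w)) A)%E.
  rewrite [RHS](eq_measure_integral (pushforward Q fst)); last first.
    by move=> D mD _; rewrite /= /pushforward Qfst.
  rewrite ge0_integral_pushforward//; last exact: measurable_funTS.
  by apply: eq_integral => w _; rewrite /X' -ltnS im.
(* An old transition is inherited through the first projection; the last one is the defining
   property of [Q]. *)
have [im1|im1] := boolP (i.+1 <= m)%N.
  have -> : X' i.+1 = cp_X V i.+1 \o fst by apply/funext => w; rewrite /X' im1.
  rewrite -[X in Q X]/(fst @^-1` (B `&` cp_X V i.+1 @^-1` A)) Qfst; last first.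
    apply: measurableI => //; rewrite -[_ @^-1` _]setTI; exact: mX.
  rewrite (cp_transition im1 mA FB).
  by apply: eq_integral => w _; rewrite Va.
have -> : X' i.+1 = snd by apply/funext => w; rewrite /X' (negbTE im1).
have -> : i = m by apply/eqP; rewrite eqn_leq -ltnS im/= leqNgt.
by rewrite -[RHS]QE.
Qed.

End FeedbackStrategy.

(** * Supermartingale estimate for the killed process under a feedback *)

Section FeedbackEstimate.
Context {R : realType} {E U : pmetricType R}.
Variables (P : R.-pker (borel (E * U)%type) ~> (borel E)) (u : E -> U).
Hypothesis measurable_graph : measurable_fun [set: borel E]
  ((fun x => (x, u x)) : borel E -> borel (E * U)%type).
Variables (D : set E) (f : E -> R) (delta eps : R).
Hypothesis mD : measurable (D : set (borel E)).
Hypothesis mf : measurable_fun [set: borel E] f.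
Hypothesis f0 : forall x, 0 <= f x.
Hypothesis delta01 : 0 <= delta <= 1.
Hypothesis eps0 : 0 <= eps.
Hypothesis f_excessive : forall x, D x ->
  (delta%:E * \int[P (x, u x)]_(y in D) (f y)%:E <= (f x + eps)%:E)%E.

Variables (m : nat) (x : E) (V : strategy P m x).
Hypothesis Vu : forall i w, cp_a V i w = u (cp_X V i w).
Hypothesis Dx : D x.

Let T := cp_Omega V.
Let X i : T -> borel E := cp_X V i.
(** Time 0 is included, unlike in [Phat], so that [f_excessive] applies at [X j] on this event for
    every [j]. *)
Let stay j : set T := [set w | forall i, (i <= j)%N -> D (X i w)].

Let mX i : (i <= m)%N -> measurable_fun [set: T] (X i).
Proof.
move=> im _ A mA; rewrite setTI.
by apply: (cp_F_measurable im); exact: cp_X_adapted.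
Qed.

Let stayS j : stay j.+1 = stay j `&` X j.+1 @^-1` D.
Proof.
apply/seteqP; split => w.
  by move=> h; split; [move=> i ij; apply: h; rewrite leqW|exact: h].
by move=> [h1 h2] i; rewrite leq_eqVlt => /predU1P[->//|]; rewrite ltnS;
  exact: h1.
Qed.

Let stay_F j : (j <= m)%N -> cp_F V j (stay j).
Proof.
elim: j => [_|j ih jm].
  rewrite (_ : stay 0%N = X 0%N @^-1` D); first exact: cp_X_adapted.
  apply/seteqP; split => w; first by move=> h; exact: h.
  by move=> h i; rewrite leqn0 => /eqP ->.
rewrite stayS -(measurable_g_measurableTypeE (cp_F_sigma V jm)).
apply: measurableI; rewrite measurable_g_measurableTypeE; try exact: cp_F_sigma.
  by apply: (cp_F_incr _ (ih (ltnW jm))); rewrite leqnSn.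
exact: cp_X_adapted.
Qed.

Let mstay j : (j <= m)%N -> measurable (stay j).
Proof. by move=> jm; exact: (cp_F_measurable jm (stay_F jm)). Qed.

(** Since [stay j] belongs to F_j, [cp_transition] disintegrates the law of [X j.+1] on that event;
    the lemma on disintegrated integrals passes from sets to functions. *)
Let integral_step j : (j < m)%N ->
  (\int[cp_Pr V]_(w in stay j.+1) (f (X j.+1 w))%:E =
   \int[cp_Pr V]_(w in stay j) \int[P (X j w, u (X j w))]_(y in D) (f y)%:E)%E.
Proof.
move=> jm; have mSj := mstay (ltnW jm).
have mg : measurable_fun [set: T] ((fun w => (X j w, u (X j w))) :
    T -> borel (E * U)%type).
  by apply: (measurableT_comp measurable_graph); exact: mX (ltnW jm).
pose g := (EFin \o f) \_ D.
have g0 y : (0 <= g y)%E by apply: erestrict_ge0 => z _; rewrite lee_fin.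
have mg' : measurable_fun [set: borel E] g.
  apply/(measurable_restrictT _ mD); apply: measurable_funTS.
  exact/measurable_EFinP.
pose nu := pushforward (mrestr (cp_Pr V) mSj) (X j.+1).
have nuE A : measurable A -> nu A = (\int[cp_Pr V]_(w in stay j) kpullback P mg w A)%E.
  move=> mA; rewrite /nu /= /pushforward /mrestr setIC.
  rewrite (cp_transition jm mA (stay_F (ltnW jm))).
  by apply: eq_integral => w _; rewrite Vu.
have stayE : (\int[cp_Pr V]_(w in stay j) (g \o X j.+1) w =
    \int[cp_Pr V]_(w in stay j.+1) (f (X j.+1 w))%:E)%E.
  rewrite integral_mkcond [RHS]integral_mkcond; apply: eq_integral => w _.
  by rewrite stayS !patchE in_setI /=; case: (w \in stay j).
have mX1 := mX jm.
have H := integral_disintegration (k := kpullback P mg) mSj nuE g0 mg'.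
rewrite -stayE -(integral_mrestr (cp_Pr V) mSj) => [|w|]; last 2 first.
- exact: g0.
- exact: measurableT_comp.
transitivity (\int[cp_Pr V]_(w in stay j) \int[kpullback P mg w]_y g y)%E.
  by rewrite -(H mX1) ge0_integral_pushforward.
by apply: eq_integral => w _; rewrite [RHS]integral_mkcond.
Qed.

(* The process starts from [x] only almost surely. *)
Let N : set T := ~` (X 0%N @^-1` [set x]).

Let mN : measurable N.
Proof.
apply: measurableC; rewrite -[_ @^-1` _]setTI; apply: mX => //.
rewrite -[X in measurable X]setCK; apply: measurableC; apply: sub_sigma_algebra.
apply: closed_openC; apply: accessible_closed_set1.
by apply: hausdorff_accessible; exact: metric_hausdorff.
Qed.

Let N0 : cp_Pr V N = 0%E.
Proof.
transitivity (1 - cp_Pr V (X 0%N @^-1` [set x]))%E.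
  by apply: probability_setC; rewrite -[X in measurable X]setCK;
    exact: measurableC.
by rewrite [cp_Pr V _]cp_X0 subee.
Qed.

(** Iteration of [f_excessive] along the process killed outside [D]. Each step adds at most [eps],
    as its error is multiplied by a power of [delta] and by a probability. *)
Let lower_bound j : (j <= m)%N ->
  ((delta ^+ j)%:E * \int[cp_Pr V]_(w in stay j) (f (X j w))%:E
   <= (f x + j%:R * eps)%:E)%E.
Proof.
have [d0 d1] := andP delta01.
elim: j => [_|j ih jm].
  rewrite expr0 mul1e mul0r addr0.
  apply: (@le_trans _ _ (\int[cp_Pr V]_(w in stay 0%N) (f x)%:E)%E).
    apply: ae_ge0_le_integral => //; try exact: mstay.
    - by move=> w _; rewrite lee_fin.
    - apply: measurable_funTS; apply/measurable_EFinP.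
      by apply: (measurableT_comp mf); exact: mX.
    - by move=> w _; rewrite lee_fin.
    exists N; split => // w; apply: contra_not => /= -> _.
    by rewrite lexx.
  rewrite integral_cst; last exact: mstay.
  rewrite -[leRHS]mule1; apply: lee_wpmul2l; first by rewrite lee_fin.
  by apply: probability_le1; exact: mstay.
have mSj := mstay (ltnW jm).
have mfX : measurable_fun (stay j) (fun w => (f (X j w))%:E).
  apply: measurable_funTS; apply/measurable_EFinP.
  by apply: (measurableT_comp mf); exact: mX (ltnW jm).
have mg : measurable_fun [set: T] ((fun w => (X j w, u (X j w))) :
    T -> borel (E * U)%type).
  by apply: (measurableT_comp measurable_graph); exact: mX (ltnW jm).
have mI : measurable_fun [set: T]
    (fun w => \int[P (X j w, u (X j w))]_(y in D) (f y)%:E)%E.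
  under eq_fun do rewrite integral_mkcond.
  apply: (measurable_fun_integral_kernel (l := kpullback P mg)).
  - by move=> A mA; exact: measurable_kernel.
  - by move=> y; apply: erestrict_ge0 => z _; rewrite lee_fin.
  - apply/(measurable_restrictT _ mD); apply: measurable_funTS.
    exact/measurable_EFinP.
have I0 w : (0 <= \int[P (X j w, u (X j w))]_(y in D) (f y)%:E)%E.
  by apply: integral_ge0 => y _; rewrite lee_fin.
rewrite integral_step// exprSr EFinM -muleA.
apply: (@le_trans _ _ ((delta ^+ j)%:E *
    (\int[cp_Pr V]_(w in stay j) (f (X j w))%:E + eps%:E))%E).
  apply: lee_wpmul2l; first by rewrite lee_fin exprn_ge0.
  rewrite -ge0_integralZl//; last exact: measurable_funTS.
  apply: (@le_trans _ _
      (\int[cp_Pr V]_(w in stay j) ((f (X j w))%:E + eps%:E))%E).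
    apply: ge0_le_integral => //.
    - by move=> w _; rewrite mule_ge0.
    - by apply: measurable_funeM; exact: measurable_funTS.
    - by apply: emeasurable_funD => //; exact: measurable_cst.
    - by move=> w Sw; rewrite -EFinD; apply: f_excessive; exact: Sw.
  rewrite ge0_integralD//; last by move=> w _; rewrite lee_fin.
  apply: leeD => //; rewrite integral_cst// -[leRHS]mule1.
  by apply: lee_wpmul2l; [rewrite lee_fin|exact: probability_le1].
rewrite ge0_muleDr//; last by apply: integral_ge0 => w _; rewrite lee_fin.
rewrite -addn1 natrD mulrDl mul1r addrA EFinD; apply: leeD;
  first exact: ih (ltnW jm).
by rewrite -EFinM lee_fin ler_piMl// exprn_ile1.
Qed.

(** Markov's inequality at the final time, applied to [lower_bound]. *)
Lemma Phat_le_excessive (b : E) (n : nat) (h : R) : D = Bn b n -> 0 <= h ->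
  ((delta ^+ m * h)%:E * Phat b n V [set y | (h < f y)%R]
   <= (f x + m%:R * eps)%:E)%E.
Proof.
move=> DE h0; apply: le_trans (lower_bound (leqnn m)).
have [d0 d1] := andP delta01.
rewrite EFinM -muleA; apply: lee_wpmul2l; first by rewrite lee_fin exprn_ge0.
have mSm := mstay (leqnn m); have mXm := mX (leqnn m).
pose O : set (borel E) := [set y | (h < f y)%R].
have mO : measurable O.
  rewrite (_ : O = setT `&` f @^-1` `]h, +oo[%classic); first exact: mf.
  by apply/seteqP; split => y; rewrite setTI /O /= in_itv/= andbT.
pose B := stay m `&` X m @^-1` O.
have mB : measurable B.
  by apply: measurableI => //; rewrite -[_ @^-1` _]setTI; exact: mXm.
apply: (@le_trans _ _ (\int[cp_Pr V]_(w in B) h%:E)%E).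
  rewrite integral_cst//; apply: lee_wpmul2l; first by rewrite lee_fin.
  rewrite /Phat; set S := (X in cp_Pr V X).
  have mS : measurable S.
    rewrite (_ : S = (\bigcap_i (if (1 <= i <= m)%N then X i @^-1` D else setT))
        `&` X m @^-1` O).
      apply: measurableI; last by rewrite -[_ @^-1` _]setTI; exact: mXm.
      apply: bigcapT_measurable => i; case: ifPn => // /andP[_ im].
      by rewrite -[_ @^-1` _]setTI; exact: mX.
    apply/seteqP; split => w; rewrite /S -DE => -[h1 h2]; split => // i.
      by move=> _; case: ifPn => // /h1.
    by move=> im; have := h1 i Logic.I; rewrite im.
  (* [Phat] does not constrain the state at time 0; off the null set [N] it is [x], which lies in
     [D]. *)
  rewrite -[leRHS]adde0 -N0; apply: le_trans (measureU2 _ _ _) => //.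
  apply: le_measure; rewrite ?inE//; first exact: measurableU.
  move=> w [h1 h2]; have [X0|X0] := pselect (X 0%N w = x); last by right.
  left; split => // -[|i] im; first by rewrite X0.
  by rewrite DE; apply: h1.
apply: (@le_trans _ _ (\int[cp_Pr V]_(w in B) (f (X m w))%:E)%E).
  apply: ge0_le_integral => //.
  - apply: measurable_funTS; apply/measurable_EFinP.
    exact: measurableT_comp mf mXm.
  - by move=> w [_ /ltW]; rewrite lee_fin.
apply: ge0_subset_integral => //.
- apply: measurable_funTS; apply/measurable_EFinP.
  exact: measurableT_comp mf mXm.
- by move=> w _; rewrite lee_fin.
- exact: subIsetl.
Qed.

End FeedbackEstimate.

(** * A nonlinear Perron-Frobenius theorem *)

Section BoundedContinuous.
Context {R : realType} {E : topologicalType}.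
Implicit Types f g w : E -> R.

Definition bounded_continuous f :=
  continuous f /\ exists M, forall x, `|f x| <= M.

Definition admissible f := bounded_continuous f /\ forall x, 0 <= f x.

Lemma bounded_continuous_cst (k : R) : bounded_continuous (fun _ : E => k).
Proof. by split; [move=> x; exact: cvg_cst|exists `|k|]. Qed.

Lemma bounded_continuousZ k (f : E -> R) :
  bounded_continuous f -> bounded_continuous (fun x => k * f x).
Proof.
move=> [cf [M fM]]; split.
  by move=> x; apply: cvgM; [exact: cvg_cst|exact: cf].
by exists (`|k| * M) => x; rewrite normrM ler_wpM2l.
Qed.

Lemma bounded_continuousB (f g : E -> R) : bounded_continuous f ->
  bounded_continuous g -> bounded_continuous (fun x => f x - g x).
Proof.
move=> [cf [M fM]] [cg [N gN]]; split.
  by move=> x; apply: cvgB; [exact: cf|exact: cg].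
by exists (M + N) => x; rewrite (le_trans (ler_normB _ _))// lerD.
Qed.

Lemma admissible_cst (k : R) : 0 <= k -> admissible (fun _ => k).
Proof. by move=> k0; split => //; exact: bounded_continuous_cst. Qed.

Lemma admissibleZ (k : R) f : 0 <= k -> admissible f -> admissible (fun x => k * f x).
Proof.
move=> k0 [bf f0]; split; first exact: bounded_continuousZ.
by move=> x; rewrite mulr_ge0.
Qed.

Lemma admissible_expR w : bounded_continuous w -> admissible (fun x => expR (w x)).
Proof.
move=> [cw [M wM]]; split; last by move=> x; exact: expR_ge0.
split; first by move=> x; apply: continuous_comp;
  [exact: cw|exact: continuous_expR].
exists (expR M) => x; rewrite ger0_norm ?expR_ge0// ler_expR.
by rewrite (le_trans (ler_norm _)).
Qed.

Lemma admissible_le_gt0 f : admissible f -> exists2 M : R, 0 < M & forall x, f x <= M.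
Proof.
move=> [[_ [M fM]] _]; exists (Num.max 1 M); first by rewrite lt_max ltr01.
by move=> x; rewrite le_max (le_trans (ler_norm _) (fM x)) orbT.
Qed.

End BoundedContinuous.

(** Compactness of a segment in terms of ultrafilters. A single ultrafilter gives limits at all
    points of [E] at once, which replaces a diagonal extraction of subsequences. *)
Lemma ultra_bounded_cvg (R : realType) (I : Type) (G : set_system I)
    (u : I -> R) (M : R) : UltraFilter G -> (forall i, `|u i| <= M) ->
  exists l : R, u @ G --> l.
Proof.
move=> GU uM.
have cM : compact `[- M, M]%classic by exact: segment_compact.
have [l [_ cl]] : `[- M, M]%classic `&` cluster (u @ G) !=set0.
  apply: cM; rewrite /= ; apply: filterE => i /=.
  by rewrite in_itv/= -ler_norml.
exists l => V /= Vl.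
have [//|GV] := in_ultra_setVsetC (u @^-1` V) GU.
have [x [/= nVx Vx]] := cl (~` V) V GV Vl.
by exfalso; exact: nVx.
Qed.

Lemma le_cvg_dist (R : realType) (I : Type) (G : set_system I) (u v : I -> R)
    (k l e : R) : ProperFilter G -> u @ G --> k -> v @ G --> l ->
  (\forall i \near G, `|u i - v i| <= e) -> `|k - l| <= e.
Proof.
move=> PG uk vl h.
have uvkl : (fun i => `|u i - v i|) @ G --> `|k - l|.
  by apply: cvg_norm; exact: cvgB.
by rewrite -(cvg_lim _ uvkl)//; apply: limr_le => //; apply/cvg_ex;
  exists `|k - l|.
Qed.

Section NonlinearPerronFrobenius.
Context {R : realType} {E : topologicalType}.
Variables (K : set E) (T : (E -> R) -> E -> R) (C : R).

Hypothesis K_compact : compact K.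
Hypothesis K_neq0 : K !=set0.
Hypothesis T_ge0 : forall f x, admissible f -> 0 <= T f x.
Hypothesis T_cst1 : forall x, expR (- C) <= T (cst 1) x.
(** Several properties in one: monotonicity ([s = 1], [t = 0]), homogeneity ([t = 0]), a Lipschitz
    bound ([s = 1]), an upper bound ([s = 0]), and the fact that only values on [K] matter. *)
Hypothesis T_le : forall f g (s t : R), admissible f -> admissible g -> 0 <= s -> 0 <= t ->
  (forall y, K y -> f y <= s * g y + t) ->
  forall x, T f x <= s * T g x + t * expR C.
Hypothesis T_equicontinuous : forall x (e : R), 0 < e -> \forall y \near x,
  forall f, admissible f -> (forall z, K z -> f z <= 1) -> `|T f y - T f x| <= e.
Hypothesis eigenfunction_gt0 : forall f kappa, admissible f -> `|kappa| <= C ->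
  (exists2 x, K x & f x = 1) -> (forall x, K x -> f x <= 1) ->
  (forall x, T f x = expR kappa * f x) -> forall x, K x -> 0 < f x.

Let T_le1 f x : admissible f -> (forall y, K y -> f y <= 1) -> T f x <= expR C.
Proof.
move=> af f1; rewrite -[leRHS]mul1r -[leRHS]add0r -(mul0r (T (cst 1) x)).
apply: T_le => //; first exact: admissible_cst.
by move=> y Ky; rewrite mul0r add0r f1.
Qed.

Let T_leZ f g (s : R) x : admissible f -> admissible g -> 0 <= s ->
  (forall y, K y -> f y <= s * g y) -> T f x <= s * T g x.
Proof.
move=> af ag s0 fg; rewrite -[leRHS]addr0 -(mul0r (expR C)).
by apply: T_le => // y Ky; rewrite addr0 fg.
Qed.

Let TZ f (s : R) x : admissible f -> 0 < s -> T (fun y => s * f y) x = s * T f x.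
Proof.
move=> af s0; have asf := admissibleZ (ltW s0) af.
apply/eqP; rewrite eq_le; apply/andP; split; first by apply: T_leZ => //;
  exact: ltW.
rewrite -ler_pdivlMl//; apply: T_leZ => //; first by rewrite invr_ge0 ltW.
by move=> y _; rewrite mulKf// gt_eqF.
Qed.

Let admissible_T f : admissible f -> admissible (T f).
Proof.
move=> af; have [M M0 fM] := admissible_le_gt0 af.
(* [T_equicontinuous] concerns functions bounded by 1 on [K], hence the rescaling. *)
pose g x := M^-1 * f x.
have M0' : 0 <= M^-1 by rewrite invr_ge0 ltW.
have ag : admissible g by exact: admissibleZ.
have g1 x : g x <= 1 by rewrite /g ler_pdivrMl// mulr1.
have TfE x : T f x = M * T g x.
  by rewrite TZ ?invr_gt0// mulVKf// gt_eqF.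
split; last by move=> x; exact: T_ge0.
split.
  move=> x; apply/cvgrPdist_le => e e0.
  have Me : 0 < M^-1 * e by rewrite mulr_gt0 ?invr_gt0.
  move: (T_equicontinuous x Me); apply: filterS => y /(_ g ag) h.
  rewrite !TfE -mulrBr normrM gtr0_norm// distrC -ler_pdivlMl//.
  by apply: h => z _; exact: g1.
exists (M * expR C) => x; rewrite ger0_norm ?T_ge0// TfE ler_pM2l//.
exact: T_le1.
Qed.

Let S (w : E -> R) (x : E) := ln (T (fun y => expR (w y)) x).

Let T_expR_gt0 w x : bounded_continuous w -> 0 < T (fun y => expR (w y)) x.
Proof.
move=> bw; have [_ [M wM]] := bw.
have h y : K y -> cst 1 y <= expR M * expR (w y).
  move=> _; rewrite -expRD -expR0 ler_expR -lerBlDl sub0r.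
  by rewrite lerNl; rewrite (le_trans _ (wM y))// -normrN ler_norm.
have h1 := T_leZ x (admissible_cst ler01) (admissible_expR bw) (expR_ge0 M) h.
 rewrite -(pmulr_rgt0 _ (expR_gt0 M)).
by rewrite (lt_le_trans _ h1)// (lt_le_trans _ (T_cst1 x))// expR_gt0.
Qed.

Let expRS w x : bounded_continuous w -> expR (S w x) = T (fun y => expR (w y)) x.
Proof. by move=> bw; rewrite lnK// posrE T_expR_gt0. Qed.

(** Homogeneity of [T] in additive form: adding [t] to [v] multiplies its exponential by
    [expR t]. *)
Let S_le w v (t : R) x : bounded_continuous w -> bounded_continuous v ->
  (forall y, K y -> w y <= v y + t) -> S w x <= S v x + t.
Proof.
move=> bw bv wv; rewrite -ler_expR expRD !expRS// mulrC.
apply: T_leZ; [exact: admissible_expR|exact: admissible_expR|exact: expR_ge0|].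
by move=> y Ky; rewrite -expRD ler_expR addrC wv.
Qed.

Let S_dist w v (t : R) x : bounded_continuous w -> bounded_continuous v ->
  (forall y, K y -> `|w y - v y| <= t) -> `|S w x - S v x| <= t.
Proof.
move=> bw bv wv; rewrite ler_distl; apply/andP; split.
  by rewrite lerBlDr; apply: S_le => // y /wv; rewrite ler_distlC => /andP[].
by apply: S_le => // y /wv; rewrite ler_distl => /andP[].
Qed.

Let S_bound w (b : R) x : bounded_continuous w -> (forall y, `|w y| <= b) ->
  `|S w x| <= C + b.
Proof.
move=> bw wb.
have S0 : `|S (cst 0) x| <= C.
  rewrite ler_norml -(ler_expR (- C)) -(ler_expR _ C) expRS;
    last exact: bounded_continuous_cst.
  rewrite (_ : (fun _ => _) = cst 1); last by apply/funext => y; rewrite expR0.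
  by rewrite T_cst1/=; apply: T_le1 => //; exact: admissible_cst.
rewrite -[S w x](subrK (S (cst 0) x)) addrC (le_trans (ler_normD _ _))// lerD//.
by apply: S_dist => //; [exact: bounded_continuous_cst|move=> y _;
  rewrite subr0].
Qed.

Let bounded_continuous_S w : bounded_continuous w -> bounded_continuous (S w).
Proof.
move=> bw; have [_ [M wM]] := bw; split.
  move=> x; apply: (@continuous_comp _ _ _ (T _) (@ln R)).
    by have [[/(_ x)]] := admissible_T (admissible_expR bw).
  by apply: continuous_ln; exact: T_expR_gt0.
by exists (C + M) => x; exact: S_bound.
Qed.

(* The discounted operator is a [beta]-contraction: its orbit provides
   approximate fixed points, without any completeness argument. *)
Let discounted_orbit (beta : R) j := iter j (fun w => S (fun x => beta * w x)) (cst 0).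

Let approx_discounted (beta e : R) : 0 <= beta < 1 -> 0 < e -> exists w,
  [/\ bounded_continuous w, forall x, (1 - beta) * `|w x| <= C &
      forall x, `|S (fun y => beta * w y) x - w x| <= e].
Proof.
move=> /andP[b0 b1] e0; pose w j := discounted_orbit beta j.
have C0 : 0 <= C.
  have [z _] := K_neq0.
  have := @S_bound (cst 0) 0 z (bounded_continuous_cst 0).
  by rewrite addr0 => h; apply: le_trans (normr_ge0 _) (h _) => y;
    rewrite normr0.
have bw j : bounded_continuous (w j).
  elim: j => [|j ih]; first exact: bounded_continuous_cst.
  by apply: bounded_continuous_S; exact: bounded_continuousZ.
(* [C / (1 - beta)] is the fixed point of [t |-> C + beta * t], so the bound passes from each
   iterate to the next. *)
have wC j x : (1 - beta) * `|w j x| <= C.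
  have b1' : 0 < 1 - beta by rewrite subr_gt0.
  rewrite -ler_pdivlMl//; elim: j x => [|j ih] x.
    by rewrite /w/= normr0 mulr_ge0// invr_ge0 ltW.
  apply: (@le_trans _ _ (C + beta * ((1 - beta)^-1 * C))).
    apply: S_bound; first exact: bounded_continuousZ.
    by move=> y; rewrite normrM ger0_norm// ler_wpM2l.
  by rewrite le_eqVlt; apply/orP; left; apply/eqP; field; rewrite gt_eqF.
(* The difference of consecutive iterates is the fixed-point defect of the earlier one, and it
   decays geometrically. *)
have dw j x : `|w j.+1 x - w j x| <= C * beta ^+ j.
  elim: j x => [|j ih] x.
    rewrite expr0 mulr1 /w/= subr0 -[leRHS]addr0; apply: S_bound.
      by apply: bounded_continuousZ; exact: bounded_continuous_cst.
    by move=> y; rewrite /cst mulr0 normr0.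
  apply: (@S_dist (fun y => beta * w j.+1 y) (fun y => beta * w j y)).
  - exact: bounded_continuousZ.
  - exact: bounded_continuousZ.
  move=> y _; rewrite -mulrBr normrM ger0_norm// exprS mulrCA ler_wpM2l//.
have : (fun j => C * beta ^+ j) @ \oo --> C * 0.
  by apply: cvgM; [exact: cvg_cst|apply: cvg_expr; rewrite ger0_norm].
rewrite mulr0 => /cvgrPdist_le /(_ _ e0) [N _ /(_ N (leqnn _))].
rewrite /= sub0r normrN => hN.
exists (w N); split => // x.
by rewrite (le_trans (dw N x))// (le_trans (ler_norm _)).
Qed.

(** Let [w] almost solve the discounted equation, let [xm] maximize [w] on [K], and let
    [v = w - w xm]. Pulling constants out of [S] shows that [S (beta v) - (1 - beta) * w xm] is
    close to [v]. So [p = expR (beta v)] and [kappa = (1 - beta) * w xm] work up to the gap between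
    [expR (beta v)] and [expR v]. *)
Let approx_eigenfunction (e : R) : 0 < e -> exists p kappa,
  [/\ admissible p, `|kappa| <= C, exists2 x, K x & p x = 1,
      forall x, K x -> p x <= 1 &
      forall x, K x -> `|expR (- kappa) * T p x - p x| <= e].
Proof.
(* [d] is both [1 - beta] and the tolerance: a defect [ln (1 + d)] in [S] is a factor between
   [1 - d] and [1 + d] after exponentiation, and [e] pays for [d] twice. *)
move=> e0; pose d := Num.min (e / 2) 1.
have d0 : 0 < d by rewrite lt_min divr_gt0/=.
have d1 : d <= 1 by rewrite ge_min lexx orbT.
have de : d + d <= e.
  by rewrite [leRHS]splitr; apply: lerD; rewrite ge_min lexx.
have eps0 : 0 < ln (1 + d) by rewrite ln_gt0// ltrDl.
have expd : expR (ln (1 + d)) = 1 + d by rewrite lnK// posrE addr_gt0.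
have expNd : 1 - d <= expR (- ln (1 + d)).
  rewrite expRN expd -[leRHS]mul1r ler_pdivlMr ?addr_gt0//.
  by rewrite -subr_sqr expr1n gerBl sqr_ge0.
have beta01 : 0 <= 1 - d < 1 by rewrite subr_ge0 d1 gtrBl.
have [w [bw wC Sw]] := approx_discounted beta01 eps0.
have [xm /set_mem Kxm wxm] : exists2 c, c \in K & forall t, t \in K -> w t <= w c.
  by apply: compact_EVT_max => //; apply: continuous_subspaceT; case: bw.
pose beta := 1 - d; pose v x := w x - w xm.
have v0 x : K x -> v x <= 0 by move=> Kx; rewrite subr_le0 wxm// inE.
have bv : bounded_continuous v.
  by apply: bounded_continuousB => //; exact: bounded_continuous_cst.
have bbv := bounded_continuousZ beta bv.
exists (fun x => expR (beta * v x)), (d * w xm); split.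
- exact: admissible_expR.
- by rewrite normrM gtr0_norm// -[d](subKr 1); exact: wC.
- by exists xm => //; rewrite /v subrr mulr0 expR0.
- by move=> x Kx; rewrite -expR0 ler_expR mulr_ge0_le0 ?v0//; case/andP: beta01.
move=> x Kx; rewrite -expRS// -expRD.
have Sv : `|- (d * w xm) + S (fun y => beta * v y) x - v x| <= ln (1 + d).
  have bw' := bounded_continuousZ beta bw.
  have -> : S (fun y => beta * v y) x = S (fun y => beta * w y) x - beta * w xm.
    apply/eqP; rewrite eq_le; apply/andP; split.
      by apply: S_le => // y _; rewrite /v mulrBr.
    by rewrite lerBlDr; apply: S_le => // y _; rewrite /v mulrBr subrK.
  rewrite (_ : _ - v x = S (fun y => beta * w y) x - w x) ?Sw//.
  by rewrite /v /beta; ring.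
have [/andP[b0 b1]] := beta01.
have ev1 : expR (v x) <= expR (beta * v x).
  by rewrite ler_expR -[leLHS]mul1r ler_wnM2r ?v0// ltW.
(* Tangent lines of the exponential at [beta * v x]. *)
have ev2 : expR (beta * v x) <= expR (v x) + d.
  have h1 : expR (beta * v x) * (1 + d * v x) <= expR (v x).
    rewrite [leRHS](_ : _ = expR (beta * v x) * expR (d * v x)).
      by rewrite ler_pM2l ?expR_gt0// expR_ge1Dx.
    by rewrite -expRD -mulrDl /beta subrK mul1r.
  have h2 : expR (beta * v x) * (1 - beta * v x) <= 1.
    rewrite -ler_pdivlMl ?expR_gt0// mulr1 -expRN.
    exact: expR_ge1Dx.
  have := expR_gt0 (v x).
  have := expR_gt0 (beta * v x).
  move: h1 h2; rewrite /beta; set A := expR _; set B := expR _.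
  by move=> h1 h2 A0 B0; nra.
have p1 : expR (beta * v x) <= 1.
  by rewrite -expR0 ler_expR mulr_ge0_le0 ?v0.
move: Sv; set Y := _ + S _ _; rewrite ler_distl => /andP[Y1 Y2].
have Y1' : expR (v x) * (1 - d) <= expR Y.
  rewrite (le_trans _ (_ : expR (v x - ln (1 + d)) <= _)) ?ler_expR//.
  by rewrite expRD ler_pM2l ?expR_gt0.
have Y2' : expR Y <= expR (v x) * (1 + d).
  by rewrite -expd -expRD ler_expR.
have := expR_gt0 (v x).
rewrite ler_norml.
move: ev1 ev2 p1 Y1' Y2'; set A := expR (v x); set B := expR (_ * _);
  set D := expR _.
by move=> *; apply/andP; split; nra.
Qed.

Theorem nonlinear_Perron_Frobenius : exists f kappa,
  [/\ admissible f, exists2 eta, 0 < eta & forall x, eta <= f x &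
      forall x, T f x = expR kappa * f x].
Proof.
have /choice[p /choice[kap pkap]] : forall n, exists p kappa,
    [/\ admissible p, `|kappa| <= C, exists2 x, K x & p x = 1,
      forall x, K x -> p x <= 1 &
      forall x, K x -> `|expR (- kappa) * T p x - p x| <= n.+1%:R^-1].
  by move=> n; apply: approx_eigenfunction; rewrite invr_gt0.
have ap n : admissible (p n) by case: (pkap n).
have p1 n x : K x -> p n x <= 1 by move=> Kx; case: (pkap n) => _ _ _ /(_ x Kx).
have kC n : `|kap n| <= C by case: (pkap n).
(* Nothing is known about the equicontinuity of the [p n], but the [q n] are images under [T], hence
   equicontinuous, and they approach the [p n] uniformly on [K]. *)
pose q n x := expR (- kap n) * T (p n) x.
have q0 n x : 0 <= q n x by rewrite mulr_ge0 ?expR_ge0 ?T_ge0.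
have qM n x : `|q n x| <= expR C * expR C.
  rewrite ger0_norm//; apply: ler_pM; [exact: expR_ge0|exact: T_ge0| |].
    by rewrite ler_expR lerNl; have := kC n; rewrite ler_norml => /andP[].
  exact: T_le1 (p1 n).
have [G [GU ooG]] := @ultraFilterLemma nat \oo _.
have PG : ProperFilter G by exact: ultra_proper.
have /choice[f qf] : forall x, exists l : R, q ^~ x @ G --> l.
  by move=> x; apply: ultra_bounded_cvg => n; exact: qM.
have [kappa kk] := ultra_bounded_cvg GU kC.
have q_eq x e : 0 < e -> \forall y \near x, forall n, `|q n y - q n x| <= e.
  move=> e0; have e0' : 0 < expR (- C) * e by rewrite mulr_gt0 ?expR_gt0.
  move: (T_equicontinuous x e0'); apply: filterS => y h n.
  rewrite /q -mulrBr normrM ger0_norm ?expR_ge0//.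
  rewrite (le_trans (ler_wpM2l (expR_ge0 _) (h _ (ap n) (p1 n))))//.
  rewrite mulrA -expRD ler_piMl ?(ltW e0)// -expR0 ler_expR.
  by have := kC n; rewrite ler_norml => /andP[] *; lra.
have cf : continuous f.
  move=> x; apply/cvgrPdist_le => e e0; move: (q_eq x e e0);
    apply: filterS => y h.
  rewrite distrC; apply: (le_cvg_dist PG (qf y) (qf x)).
  by apply: filterE => n; exact: h.
have f0 x : 0 <= f x.
  rewrite -(cvg_lim _ (qf x))//; apply: limr_ge.
    by apply/cvg_ex; exists (f x).
  by apply: filterE => n; exact: q0.
have af : admissible f.
  split => //; split => //; exists (expR C * expR C) => x.
  rewrite -[f x]subr0;
    apply: (le_cvg_dist PG (qf x) (@cvg_cst _ (0 : R) _ G _)).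
  by apply: filterE => n; rewrite subr0.
(* Equicontinuity makes the pointwise limit of [q] along [G] uniform on [K]. *)
have pf e : 0 < e -> \forall n \near G, forall x, K x -> `|p n x - f x| <= e.
  move=> e0; have e4 : 0 < e / 4 by rewrite divr_gt0.
  have cov := iffLR (compact_near_coveringP K) K_compact _ G
    (fun n x => `|q n x - f x| <= 3 * (e / 4)) _.
  have /cov {cov} : forall x, K x ->
      \forall x' \near x & n \near G, `|q n x' - f x'| <= 3 * (e / 4).
    move=> x Kx.
    have H1 := q_eq x _ e4.
    have H2 : \forall n \near G, `|q n x - f x| <= e / 4.
      by move/cvgrPdist_le : (qf x) => /(_ _ e4); apply: filterS => n;
        rewrite distrC.
    have H3 : \forall y \near x, `|f x - f y| <= e / 4.
      by move/cvgrPdist_le : (cf x) => /(_ _ e4).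
    near=> y n => /=.
    rewrite (_ : q n y - f y = (q n y - q n x) + (q n x - f x) + (f x - f y));
      last by ring.
    have -> : 3 * (e / 4) = e / 4 + e / 4 + e / 4 by field.
    rewrite (le_trans (ler_normD _ _))// lerD//; last by near: y.
    rewrite (le_trans (ler_normD _ _))// lerD//; last by near: n.
    exact: (near H1 y).
  move=> cov.
  have : \forall n \near G, n.+1%:R^-1 <= e / 4.
    by apply: ooG; have := near_infty_natSinv_lt (PosNum e4);
      apply: filterS => n /ltW.
  move: cov; apply: filterS2 => n h1 h2 x Kx.
  have [_ _ _ _ /(_ x Kx) h3] := pkap n.
  rewrite distrC (_ : f x - p n x = (q n x - p n x) - (q n x - f x));
    last by ring.
  have -> : e = e / 4 + 3 * (e / 4) by field.
  rewrite (le_trans (ler_normB _ _))// lerD//; last exact: h1.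
  exact: le_trans h3 h2.
have f1 x : K x -> f x <= 1.
  move=> Kx; apply/ler_addgt0Pr => e e0.
  have [n /(_ x Kx)] := filter_ex (pf e e0).
  by have := p1 n x Kx; rewrite ler_distl => ? /andP[]; lra.
have fx1 : exists2 x, K x & f x = 1.
  have [xm /set_mem Kxm fxm] : exists2 c, c \in K & forall t, t \in K -> f t <= f c.
    by apply: compact_EVT_max => //; exact: continuous_subspaceT.
  exists xm => //; apply/eqP; rewrite eq_le f1//=.
  apply/ler_addgt0Pr => e e0.
  have [n hn] := filter_ex (pf e e0).
  have [_ _ [y Ky pn1] _ _] := pkap n.
  have := hn y Ky; have := fxm y; rewrite inE => /(_ Ky).
  by rewrite pn1 ler_distl => ? /andP[]; lra.
(* By [T_le] with [s = 1], [T] is Lipschitz with constant [expR C] for uniform distance on [K]. *)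
have Tpf x : T ^~ x \o p @ G --> T f x.
  apply/cvgrPdist_le => e e0;
    have e0' : 0 < expR (- C) * e by rewrite mulr_gt0 ?expR_gt0.
  have -> : e = 1 * 0 + (expR (- C) * e) * expR C.
    by rewrite mulr0 add0r mulrAC -expRD addNr expR0 mul1r.
  move: (pf _ e0'); apply: filterS => n h /=.
  rewrite mulr0 add0r ler_distl; apply/andP; split.
    rewrite lerBlDr -[T f x]mul1r; apply: T_le => //; first exact: ltW.
    by move=> y /h; rewrite ler_distl => /andP[]; lra.
  rewrite -[X in _ <= X + _]mul1r; apply: T_le => //; first exact: ltW.
  by move=> y /h; rewrite ler_distl => /andP[]; lra.
have Tf x : T f x = expR kappa * f x.
  have h1 : (fun n => expR (kap n) * q n x) @ G --> expR kappa * f x.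
    apply: cvgM => //; apply: continuous_cvg => //; exact: continuous_expR.
  apply: (cvg_unique _ (Tpf x)) => //; move: h1.
  rewrite (_ : (fun n => expR (kap n) * q n x) = T ^~ x \o p)//.
  by apply/funext => n; rewrite /q mulrA -expRD subrr expR0 mul1r.
have kapC : `|kappa| <= C.
  rewrite -[kappa]subr0; apply: (le_cvg_dist PG kk (@cvg_cst _ (0 : R) _ G _)).
  by apply: filterE => n; rewrite subr0.
have fgt0 := eigenfunction_gt0 af kapC fx1 f1 Tf.
have [xm /set_mem Kxm fxm] : exists2 c, c \in K & forall t, t \in K -> f c <= f t.
  by apply: compact_EVT_min => //; exact: continuous_subspaceT.
exists f, kappa; split => //.
(* [f] is at least [f xm] on [K], and the eigenvalue equation carries this bound to all of [E],
   since [T] only looks at [K] and [T 1] is at least [expR (- C)]. *)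
exists (expR (- kappa) * (f xm * expR (- C))).
  by rewrite !mulr_gt0 ?expR_gt0 ?fgt0.
move=> x; rewrite expRN ler_pdivrMl ?expR_gt0// -Tf -ler_pdivlMl ?fgt0//.
apply: (le_trans (T_cst1 x)); apply: T_leZ => //; first exact: admissible_cst.
  by rewrite invr_ge0.
by move=> y Ky; rewrite ler_pdivlMl ?fgt0// mulr1 fxm// inE.
Unshelve. all: by end_near. Qed.

End NonlinearPerronFrobenius.

(** * The Bellman operator of the approximating process *)

(** A tube argument: on a product neighbourhood of [(x, y)], both values are within [e / 2] of the
    value at [(x, y)], and finitely many such neighbourhoods cover [Y]. *)
Lemma compact_equicontinuous_near (R : realType) (X Y : topologicalType)
    (I : Type) (D : set I) (F : I -> X * Y -> R) (x : X) :
  compact [set: Y] ->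
  (forall y e, 0 < e -> \forall z \near (x, y),
    forall i, D i -> `|F i z - F i (x, y)| <= e) ->
  forall e, 0 < e -> \forall x' \near x,
    forall y i, D i -> `|F i (x', y) - F i (x, y)| <= e.
Proof.
move=> cY eqF e e0; have e2 : 0 < e / 2 by rewrite divr_gt0.
have cov := iffLR (compact_near_coveringP _) cY _ (nbhs x)
  (fun x' y => forall i, D i -> `|F i (x', y) - F i (x, y)| <= e) _.
have /cov : forall y, [set: Y] y -> \forall y' \near y & x' \near x,
    forall i, D i -> `|F i (x', y') - F i (x, y')| <= e.
  move=> y _; have [[/= A B] [Ax By] AB] := eqF y _ e2.
  exists (B, A) => //= -[y' x'] /= [By' Ax'] i Di.
  have h1 := AB (x', y') (conj Ax' By') i Di.
  have h2 := AB (x, y') (conj (nbhs_singleton Ax) By') i Di.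
  rewrite [e]splitr (_ : F i (x', y') - _ = (F i (x', y') - F i (x, y)) -
    (F i (x, y') - F i (x, y))); last by ring.
  by rewrite (le_trans (ler_normB _ _))// lerD.
by apply: filterS => x' h y; exact: h.
Qed.

(** A control good at a point stays good nearby, so a finite subcover yields a feedback with
    finitely many values. The first listed open set containing [x] decides its control, which makes
    measurability elementary. *)
Lemma measurable_feedback_selection (R : realType) (E U : pmetricType R)
    (K : set E) (Q : U -> E -> Prop) : compact K ->
  (forall x, K x -> exists a, \forall y \near x, Q a y) ->
  exists u : E -> U, measurable_fun [set: borel E]
      ((fun x => (x, u x)) : borel E -> borel (E * U)%type) /\
    forall x, K x -> Q (u x) x.
Proof.
move=> cK KQ.
have /choice[a aQ] : forall x, exists a, K x -> \forall y \near x, Q a y.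
  by move=> x; have [/KQ[a ?]|?] := pselect (K x); [exists a|exists point].
pose O x : set E := [set y | Q (a x) y]°.
have [D DK KD] : finite_subset_cover K O K.
  move: cK; rewrite compact_cover; apply; first by move=> x _;
    exact: open_interior.
  by move=> x Kx; exists x => //; exact: aQ.
have [u [mu uQ]] : exists u : E -> U, measurable_fun [set: borel E]
    ((fun x => (x, u x)) : borel E -> borel (E * U)%type) /\
    forall x, (exists2 i, i \in (finmap.enum_fset D) & O i x) -> Q (u x) x.
  elim: (finmap.enum_fset D) => [|d s [v [mv vQ]]].
    exists (fun _ => point); split; last by move=> x [].
    apply: measurable_fun_generated => W oW; apply: sub_sigma_algebra.
    by apply: open_comp => // x _; apply: cvg_pair => //=; exact: cvg_cst.
  exists (fun x => if x \in O d then a d else v x); split.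
    apply: measurable_fun_generated => W oW.
    have mOd : measurable (O d : set (borel E)).
      by apply: sub_sigma_algebra; exact: open_interior.
    rewrite (_ : _ @^-1` W = (O d `&` (fun x => (x, a d)) @^-1` W) `|`
        (~` O d `&` (fun x => (x, v x)) @^-1` W)).
      apply: measurableU; apply: measurableI => //; last 2 first.
      - exact: measurableC.
      - rewrite -[_ @^-1` _]setTI; apply: mv => //; exact: sub_sigma_algebra.
      apply: sub_sigma_algebra.
      by apply: open_comp => // x _; apply: cvg_pair => //=; exact: cvg_cst.
    apply/seteqP; split => x /=; have [xO|xO] := boolP (x \in O d).
    - by move=> ?; left; split => //; exact: set_mem.
    - by move=> ?; right; split => // /mem_set; exact/negP.
    - by case=> -[] // /(_ (set_mem xO)).
    - by case=> -[] // /mem_set; rewrite (negbTE xO).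
  move=> x [i]; rewrite inE => ids Oix; case: ifPn => [/set_mem|xO].
    exact: interior_subset.
  apply: vQ; exists i => //; case/predU1P : ids => // id.
  by move: xO; rewrite -id mem_set.
exists u; split => // x /KD[i iD Oix]; apply: uQ; exists i => //.
Qed.

Lemma open_metric_ball (R : realType) (E : pmetricType R) (x : E) (e : R) :
  open (ball x e).
Proof.
rewrite openE => y; rewrite ballEmdist /= => xy; rewrite /interior.
apply/nbhs_ballP; exists (e - mdist x y); first by rewrite /= subr_gt0.
move=> z; rewrite !ballEmdist/= ltrBrDl.
exact: le_lt_trans (metric_triangle _ _ _).
Qed.

(** Each point off the support has a null open neighbourhood, hence lies in a null ball of radius
    [k.+1%:R^-1] centred in the countable dense set; there are countably many such balls. *)
Lemma support_negligible (R : realType) (E : pmetricType R)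
    (mu : {measure set (borel E) -> \bar R}) (A : set E) :
  separable E -> closed A -> support_of mu `<=` A -> mu (~` A) = 0%E.
Proof.
move=> [S cS dS] cA muA.
have mA : measurable (~` A : set (borel E)).
  by apply: sub_sigma_algebra; exact: closed_openC.
have /pfcard_geP[S0|[s]] : ([set: nat] #>= S)%card by [].
  have [x []] := dS setT (ex_intro _ point I) openT; by rewrite S0.
pose B (n k : nat) : set E := ball (s n) k.+1%:R^-1.
have mB n k : measurable (B n k : set (borel E)).
  by apply: sub_sigma_algebra; exact: open_metric_ball.
pose F n k := if mu (B n k) == 0%E then B n k else set0.
have F0 : mu.-negligible (\bigcup_n \bigcup_k F n k : set (borel E)).
  apply: negligible_bigcup => n; apply: negligible_bigcup => k.
  rewrite /F; case: ifPn => [/eqP B0|_]; last exact: negligible_set0.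
  by exists (B n k); split.
apply/(measure_negligible mA); apply: negligibleS F0 => x Ax.
have [W [oW Wx muW]] : exists W : set E, [/\ open W, W x & mu W = 0%E].
  have /existsNP[W /not_implyP[oW /not_implyP[Wx /negP]]] :
    ~ support_of mu x by move/muA.
  by rewrite -leNgt => muW; exists W; split => //; apply/eqP;
    rewrite eq_le muW/=.
have [e/= e0 xeW] : nbhs_ball x W by rewrite nbhs_ballE; exact: open_nbhs_nbhs.
have e20 : 0 < e / 2 by rewrite divr_gt0.
have [k _ /(_ k (leqnn _)) /= ke] := near_infty_natSinv_lt (PosNum e20).
have [y [xy Sy]] : (ball x k.+1%:R^-1 `&` S) !=set0.
  apply: dS; last exact: open_metric_ball.
  by exists x; apply: ballxx; rewrite invr_gt0.
have [n _ sn] : (s @` [set: nat]) y by apply: surj.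
exists n => //; exists k => //; rewrite /F.
suff -> : mu (B n k) = 0%E by rewrite eqxx /B sn; exact: ball_sym.
apply/eqP; rewrite eq_le measure_ge0 andbT -muW; apply: le_measure.
- by apply/mem_set; exact: mB.
- by apply/mem_set; exact: sub_sigma_algebra.
move=> z; rewrite /B sn => yz; apply: xeW.
apply: (@le_ball _ _ _ (k.+1%:R^-1 + k.+1%:R^-1)).
  by rewrite [leRHS]splitr lerD// ltW.
exact: ball_triangle yz.
Qed.

Section Truncation.
Context {R : realType} {E : pmetricType R}.
Variables (b : E) (n : nat).

(** The two weights in [Ptilde] and [cn] are [1 - cut x] and [cut x], by [cutE]. *)
Definition cut (x : E) : R := Num.min (dist_to x (Bn b n)) 1.

Lemma Bn_center : Bn b n b.
Proof. by rewrite /Bn/= mdistxx. Qed.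

Lemma dist_to_ge0 x : 0 <= dist_to x (Bn b n).
Proof.
apply: lb_le_inf; first by exists (mdist x b), b => //; exact: Bn_center.
by move=> _ [y _ <-]; exact: mdist_ge0.
Qed.

Let dist_to_le x y : Bn b n y -> dist_to x (Bn b n) <= mdist x y.
Proof.
move=> By; apply: ge_inf; last by exists y.
by exists 0 => _ [z _ <-]; exact: mdist_ge0.
Qed.

Lemma dist_to_lipschitz x y :
  dist_to x (Bn b n) <= mdist x y + dist_to y (Bn b n).
Proof.
rewrite -lerBlDl; apply: lb_le_inf; first by exists (mdist y b), b => //;
  exact: Bn_center.
move=> _ [z Bz <-]; rewrite lerBlDl.
exact: le_trans (dist_to_le x Bz) (metric_triangle _ _ _).
Qed.

Lemma cut_itv x : 0 <= cut x <= 1.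
Proof. by rewrite /cut le_min dist_to_ge0 ler01 ge_min lexx orbT. Qed.

Lemma cut_Bn x : Bn b n x -> cut x = 0.
Proof.
move=> /(dist_to_le x); rewrite mdistxx => h.
by apply/eqP; rewrite eq_le (andP (cut_itv x)).1 andbT /cut ge_min h.
Qed.

Lemma cutE x : Num.max (1 - dist_to x (Bn b n)) 0 = 1 - cut x.
Proof. by rewrite /cut; case: leP => h1; case: leP => h2; lra. Qed.

Lemma cut_near x (e : R) : 0 < e -> \forall y \near x, `|cut y - cut x| <= e.
Proof.
move=> e0; apply/nbhs_ballP; exists e => //= y;
  rewrite ballEmdist/= => /ltW xye.
have h1 := dist_to_lipschitz x y; have h2 := dist_to_lipschitz y x.
move: h1 h2; rewrite (metric_sym y x) ler_norml /cut.
by case: (leP (dist_to y _) 1) => ?; case: (leP (dist_to x _) 1) => ? ? ?;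
  apply/andP; split; lra.
Qed.

End Truncation.

Section RealInfimum.
Context {R : realType} {U : Type}.
Implicit Types F G : U -> R.

Lemma le_inf_range (a0 : U) F k :
  (forall a, k <= F a) -> k <= inf [set F a | a in [set: U]].
Proof.
by move=> kF; apply: lb_le_inf; [exists (F a0), a0|move=> _ [a _ <-]].
Qed.

Lemma inf_range_le F k a :
  (forall a, k <= F a) -> inf [set F a | a in [set: U]] <= F a.
Proof.
by move=> kF; apply: ge_inf; [exists k => _ [y _ <-]|exists a].
Qed.

End RealInfimum.

Lemma ler_dist_mul (R : realType) (a a' r r' e : R) :
  0 <= a <= 1 -> 0 <= r' <= 1 -> `|a - a'| <= e -> `|r - r'| <= e ->
  `|a * r - a' * r'| <= e + e.
Proof.
move=> /andP[a0 a1] /andP[r0 r1] aa rr.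
rewrite (_ : _ - _ = a * (r - r') + r' * (a - a')); last by ring.
rewrite (le_trans (ler_normD _ _))// !normrM (ger0_norm a0) (ger0_norm r0).
by apply: lerD; [apply: le_trans rr|apply: le_trans aa]; rewrite ler_piMl.
Qed.

(** * The approximating kernel: comparison with [P] and continuity uniform in the control *)

Section PtildeTheory.
Context {R : realType} {E U : pmetricType R}.
Variables (P : R.-pker (borel (E * U)%type) ~> (borel E)).
Variables (mu : probability (borel E) R) (b : E) (n : nat).

Let K : set (borel E) := Bn b n.
Let mK : measurable K. Proof. exact: measurable_Bn. Qed.

Let pr z (A : set (borel E)) : R := fine (P z A).
Let prE z A : measurable A -> P z A = (pr z A)%:E.
Proof.
move=> mA; rewrite fineK// ge0_fin_numE//.
apply: (@le_lt_trans _ _ (P z setT)); last by rewrite prob_kernel ltry.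
by apply: le_measure => //; apply/mem_set.
Qed.

Let pr_itv z A : measurable A -> 0 <= pr z A <= 1.
Proof.
move=> mA; rewrite -!lee_fin -prE// measure_ge0/= -(prob_kernel (s := P) z).
by apply: le_measure => //; apply/mem_set.
Qed.

Let prC z A : measurable A -> pr z (~` A) = 1 - pr z A.
Proof.
move=> mA; have mAC := measurableC mA; apply/eqP; rewrite eq_sym subr_eq.
apply/eqP/EFin_inj; rewrite EFinD -!prE// -(prob_kernel (s := P) z) -(setvU A).
by rewrite measureU// setICl.
Qed.

Let m (A : set (borel E)) : R := fine (mu A).
Let mE A : measurable A -> mu A = (m A)%:E.
Proof. by move=> mA; rewrite fineK// fin_num_measure. Qed.
Let m_itv A : measurable A -> 0 <= m A <= 1.
Proof.
by move=> mA; rewrite -!lee_fin -mE// measure_ge0 probability_le1.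
Qed.

Let d := @cut R E b n.

Let PtildeE x a A : measurable A -> Ptilde P mu b n x a A =
  ((1 - d x) * pr (x, a) (A `&` K)
   + m A * (1 - pr (x, a) K + d x * pr (x, a) K))%:E.
Proof.
move=> mA; rewrite /Ptilde cutE -/(cut b n x) (prE _ (measurableI _ _ mA mK)).
rewrite (prE _ (measurableC mK)) mE// prC//.
rewrite -[LHS]/(((1 - d x) * pr (x, a) (A `&` K) +
  m A * ((1 - pr (x, a) K) + d x * (1 - (1 - pr (x, a) K))))%:E).
by congr EFin; ring.
Qed.

Lemma Ptilde_setT x a : Ptilde P mu b n x a setT = 1%E.
Proof.
rewrite PtildeE// setTI /m probability_setT /=; congr EFin; ring.
Qed.

HB.instance Definition _ x a := Measure_isProbability.Build _ _ _
  (Ptilde P mu b n x a) (Ptilde_setT x a).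

Lemma Ptilde_setC_Bn x a : mu (~` K) = 0%E -> Ptilde P mu b n x a (~` K) = 0%E.
Proof.
move=> muK; rewrite PtildeE; last exact: measurableC.
by rewrite setICl /pr /m muK measure0/= mulr0 mul0r addr0.
Qed.

(** On [K] the cut-off vanishes and what [mu] adds is nonnegative. This is the passage from the
    approximating kernel back to the original process killed outside [K]. *)
Lemma Ptilde_ge x a A : K x -> measurable A -> A `<=` K ->
  (P (x, a) A <= Ptilde P mu b n x a A)%E.
Proof.
move=> Kx mA AK; rewrite PtildeE// prE// lee_fin /d cut_Bn// (setIidl AK).
have := pr_itv (x, a) mK; have := m_itv mA.
by set u := m A; set v := pr _ K => ? ?; nra.
Qed.

Hypothesis cU : compact [set: U].
Hypothesis P_cont : variation_continuous P.

(** [variation_continuous] is sequential; a failure of the neighbourhood form yields points in balls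
    of radius [k.+1%:R^-1] that contradict it. *)
Let P_near z (e : R) : 0 < e -> \forall z' \near z,
  forall A, measurable A -> `|pr z' A - pr z A| <= e.
Proof.
move=> e0; case: z => x a; apply: contrapT => H.
have /choice[z zH] : forall k : nat, exists z : E * U,
    [/\ ball x k.+1%:R^-1 z.1, ball a k.+1%:R^-1 z.2 &
        exists2 A, measurable A & e < `|pr z A - pr (x, a) A|].
  move=> k; apply: contrapT => Hk; apply: H.
  exists (ball x k.+1%:R^-1, ball a k.+1%:R^-1).
    by split; apply: nbhsx_ballx; rewrite invr_gt0.
  move=> z [/= z1 z2] A mA; rewrite leNgt; apply/negP => zA.
  by apply: Hk; exists z; split => //; exists A.
have cvg_seq (T : pmetricType R) (t : T) (s : nat -> T) :
    (forall k, ball t k.+1%:R^-1 (s k)) -> s @ \oo --> t.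
  move=> ts; apply/cvg_ballP => r r0.
  have := near_infty_natSinv_lt (PosNum r0); apply: filterS => k /ltW kr.
  exact: le_ball kr _ (ts k).
have z1 : (fst \o z) @ \oo --> x by apply: cvg_seq => k; case: (zH k).
have z2 : (snd \o z) @ \oo --> a by apply: cvg_seq => k; case: (zH k).
have /fine_cvgP[supf /cvgrPdist_lt /(_ _ e0) sup0] := P_cont z1 z2.
have [N [supN sup0N]] := filter_ex (filterI supf sup0).
have [_ _ [A mA eA]] := zH N.
move: sup0N; rewrite /= sub0r normrN => /(le_lt_trans (ler_norm _)).
rewrite -lte_fin fineK//; apply/negP; rewrite -leNgt.
apply: (@le_trans _ _ `|P (z N) A - P (x, a) A|%E).
  by rewrite !prE// -EFinB abse_EFin lee_fin ltW.
apply: ereal_sup_ubound; exists A => //.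
by rewrite -surjective_pairing.
Qed.

Lemma Ptilde_near x (e : R) : 0 < e -> \forall y \near x, forall a A, measurable A ->
  (Ptilde P mu b n y a A <= Ptilde P mu b n x a A + e%:E
   /\ Ptilde P mu b n x a A <= Ptilde P mu b n y a A + e%:E)%E.
Proof.
move=> e0; have e4 : 0 < e / 4 by rewrite divr_gt0.
have h1 := @compact_equicontinuous_near R E U (set (borel E)) measurable
  (fun A z => pr z A) x cU (fun a r r0 => P_near (x, a) r0) _ e4.
have h2 := cut_near b n x e4.
near=> y => a A mA; rewrite !PtildeE// -!EFinD !lee_fin.
have hy : forall a A, measurable A -> `|pr (y, a) A - pr (x, a) A| <= e / 4.
  by near: y; exact: h1.
have := hy a (A `&` K) (measurableI _ _ mA mK); have := hy a K mK.
have : `|d y - d x| <= e / 4 by near: y.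
have := cut_itv b n x; have := cut_itv b n y; rewrite -/d.
have := pr_itv (x, a) mK; have := m_itv mA.
have := pr_itv (x, a) (measurableI _ _ mA mK).
set r := pr (y, a) (A `&` K); set r' := pr (x, a) (A `&` K).
set q := pr (y, a) K; set q' := pr (x, a) K; set dx := d x; set dy := d y.
move=> r1' /andP[m0 m1] q1' d1 d1' dd qq rr.
have dd' : `|(1 - dy) - (1 - dx)| <= e / 4 by rewrite opprB addrC subrKA distrC.
have d1C : 0 <= 1 - dy <= 1 by lra.
have := ler_dist_mul d1C r1' dd' rr; have := ler_dist_mul d1C q1' dd' qq.
have -> : e / 4 + e / 4 = e / 2 by field.
rewrite !ler_norml; set D := _ - _ => /andP[D1 D2] /andP[? ?].
(* The coefficient of [mu] is [1 - (1 - d) * q], so it varies by [- D], at most [e / 2]; the term of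
   [P] accounts for the other half. *)
have mD : m A * (1 - q + dy * q) = m A * (1 - q' + dx * q') - m A * D.
  by rewrite /D; ring.
by split; nra.
Unshelve. all: by end_near. Qed.

End PtildeTheory.

(** The error is [expR q * r * (J + r + 1)], where the last factor is at most 3. *)
Lemma expR_mul_perturb (R : realType) (C r e p q J L : R) :
  0 < r -> r <= 1 -> 3 * r * expR C <= e ->
  0 <= J <= 1 -> L <= J + r -> p - q <= ln (1 + r) -> q <= C ->
  expR p * L <= expR q * J + e.
Proof.
move=> r0 r1 re /andP[J0 J1] LJ pq qC.
have expl : expR (ln (1 + r)) = 1 + r by rewrite lnK// posrE addr_gt0.
have pq' : expR p <= expR q * (1 + r).
  by rewrite -expl -expRD ler_expR -lerBlDl.
have qC' : expR q <= expR C by rewrite ler_expR.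
apply: (@le_trans _ _ (expR p * (J + r))); first by rewrite ler_wpM2l ?expR_ge0.
apply: (@le_trans _ _ (expR q * (1 + r) * (J + r))).
  by rewrite ler_wpM2r// addr_ge0// ltW.
have -> : expR q * (1 + r) * (J + r) = expR q * J + expR q * (r * (J + r + 1)) by ring.
rewrite lerD2l; apply: le_trans re.
rewrite [leRHS]mulrC; apply: ler_pM; [exact: expR_ge0| |exact: qC'|].
  by apply: mulr_ge0; lra.
by nra.
Qed.

(** * Regularity of the Bellman operator and positivity of its eigenfunctions *)

Section BellmanOperator.
Context {R : realType} {E U : pmetricType R}.
Variables (P : R.-pker (borel (E * U)%type) ~> (borel E)).
Variables (mu : probability (borel E) R) (b : E) (c : E * U -> R) (n : nat).
Variable C : R.
Implicit Types f g : E -> R.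

Hypothesis Bn_compact : compact (Bn b n).
Hypothesis U_compact : compact [set: U].
Hypothesis c_continuous : continuous c.
Hypothesis c_le : forall z, `|c z| <= C.
Hypothesis mu_Bn : mu (~` Bn b n) = 0%E.
Hypothesis P_variation_continuous : variation_continuous P.
Hypothesis P_irreducible : forall (x : E) (O : set E),
  Bn b n x -> open O -> O `&` Bn b n !=set0 ->
  exists2 m : nat, (0 < m)%N &
    (0 < ereal_inf [set p | exists V : strategy P m x, p = Phat b n V O])%E.

Let cost := cn b c n.

Definition Ptilde_mean (f : E -> R) x a : R :=
  fine (\int[Ptilde P mu b n x a]_y (f y)%:E)%E.
Let I := Ptilde_mean.

Definition bellman (f : E -> R) x : R :=
  inf [set expR (cn b c n x a) * Ptilde_mean f x a | a in [set: U]].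
Let T := bellman.

Let admissible_measurable f : admissible f -> measurable_fun [set: borel E] (EFin \o f).
Proof. by move=> [[cf _] _]; apply/measurable_EFinP;
  exact: continuous_measurable_borel. Qed.

Let int_cst x a (k : R) : (\int[Ptilde P mu b n x a]_y k%:E = k%:E)%E.
Proof.
by rewrite integral_cst// -[RHS]mule1; congr (_ * _)%E; exact: Ptilde_setT.
Qed.

Lemma Ptilde_meanE f x a : admissible f ->
  (\int[Ptilde P mu b n x a]_y (f y)%:E = (Ptilde_mean f x a)%:E)%E.
Proof.
move=> af; have [M M0 fM] := admissible_le_gt0 af;
  have mf := admissible_measurable af.
have [_ f0] := af.
rewrite fineK// ge0_fin_numE; last by apply: integral_ge0 => y _;
  rewrite lee_fin.
apply: (@le_lt_trans _ _ (\int[Ptilde P mu b n x a]_y M%:E)%E).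
  by apply: ge0_le_integral => // y _; rewrite ?lee_fin// ltW.
by rewrite int_cst ltry.
Qed.

Let I_ge0 f x a : admissible f -> 0 <= I f x a.
Proof. by move=> [_ f0]; rewrite fine_ge0// integral_ge0// => y _;
  rewrite lee_fin. Qed.

(** The complement of [Bn b n] is null for [Ptilde], so an inequality on [Bn b n] holds almost
    everywhere. *)
Let I_le f g (s t : R) x a : admissible f -> admissible g -> 0 <= s -> 0 <= t ->
  (forall y, Bn b n y -> f y <= s * g y + t) -> I f x a <= s * I g x a + t.
Proof.
move=> af ag s0 t0 fg; rewrite -lee_fin EFinD EFinM -!Ptilde_meanE//.
have [_ f0] := af; have [_ g0] := ag.
have mf := admissible_measurable af; have mg := admissible_measurable ag.
have mK := measurable_Bn b n.
have msg : measurable_fun [set: borel E] (fun y => (s * g y)%:E).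
  by under eq_fun do rewrite EFinM; exact: measurable_funeM.
apply: (@le_trans _ _ (\int[Ptilde P mu b n x a]_y ((s * g y)%:E + t%:E))%E).
  apply: ae_ge0_le_integral => //.
  - by move=> y _; rewrite lee_fin.
  - by move=> y _; rewrite -EFinD lee_fin addr_ge0// mulr_ge0.
  - exact: emeasurable_funD.
  exists (~` Bn b n); split; [exact: measurableC|exact: Ptilde_setC_Bn|].
  by move=> y; apply: contra_not => By _; rewrite -EFinD lee_fin; exact: fg.
rewrite ge0_integralD//; last by move=> y _; rewrite lee_fin mulr_ge0.
rewrite int_cst.
under eq_integral do rewrite EFinM.
by rewrite ge0_integralZl// => y _; rewrite lee_fin.
Qed.

Let I_variation f x y a (r : R) : admissible f -> (forall z, 0 <= f z <= 1) ->
  (forall A, measurable A ->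
    Ptilde P mu b n y a A <= Ptilde P mu b n x a A + r%:E)%E ->
  I f y a <= I f x a + r.
Proof.
move=> af f01 Pyx; have [[cf _] _] := af.
have := le_integral_variation Pyx f01 (continuous_measurable_borel cf).
by rewrite (Ptilde_meanE y a af) (Ptilde_meanE x a af) -EFinD lee_fin.
Qed.

Let I_cst1 x a : I (cst 1) x a = 1.
Proof. by rewrite /I /Ptilde_mean int_cst. Qed.

Let C_ge0 : 0 <= C.
Proof. exact: le_trans (c_le point). Qed.

Let inf_c : `|inf (range c)| <= C.
Proof.
have lc z : - C <= c z by have := c_le z; rewrite ler_norml => /andP[].
have cC z : c z <= C by have := c_le z; rewrite ler_norml => /andP[].
rewrite ler_norml; apply/andP; split.
  by apply: le_inf_range; [exact: point|exact: lc].
exact: le_trans (inf_range_le point lc) (cC _).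
Qed.

Let costE x a : cost x a = (1 - cut b n x) * c (x, a) + cut b n x * inf (range c).
Proof. by rewrite /cost /cn cutE. Qed.

Let cost_le x a : `|cost x a| <= C.
Proof.
rewrite costE; have /andP[d0 d1] := cut_itv b n x.
move: inf_c (c_le (x, a)); rewrite !ler_norml => /andP[? ?] /andP[? ?].
by apply/andP; split; nra.
Qed.

Let cost_near x (e : R) : 0 < e -> \forall y \near x, forall a,
  `|cost y a - cost x a| <= e.
Proof.
move=> e0; have e2 : 0 < e / 2 by rewrite divr_gt0.
have C1 : 0 < C + C + 1 by have := C_ge0; lra.
(* [C + C] bounds the distance from [c] to its infimum; adding 1 keeps the divisor positive. *)
have d0 : 0 < e / 2 / (C + C + 1) by rewrite divr_gt0.
have H1 := @compact_equicontinuous_near R E U unit setT (fun _ => c) x U_compact _ _ e2.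
have {}H1 : \forall y \near x, forall a, `|c (y, a) - c (x, a)| <= e / 2.
  have : \forall y \near x, forall a (i : unit), setT i -> `|c (y, a) - c (x, a)| <= e / 2.
    apply: H1 => a r r0.
    have /cvgrPdist_le/(_ _ r0) := @c_continuous (x, a).
    by apply: filterS => z h _ _; rewrite distrC.
  by apply: filterS => y h a; exact: (h a tt).
have H2 := cut_near b n x d0.
near=> y => a.
have h1 : forall a, `|c (y, a) - c (x, a)| <= e / 2 by near: y.
have {}h1 := h1 a.
have h2 : `|cut b n y - cut b n x| <= e / 2 / (C + C + 1) by near: y.
rewrite !costE.
rewrite (_ : _ - _ = (1 - cut b n y) * (c (y, a) - c (x, a)) -
  (cut b n y - cut b n x) * (c (x, a) - inf (range c))); last by ring.
rewrite (le_trans (ler_normB _ _))// [leRHS]splitr lerD//.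
  have /andP[? ?] := cut_itv b n y.
  rewrite normrM ger0_norm ?subr_ge0//; apply: le_trans h1.
  by rewrite ler_piMl// gerBl.
move: h2; rewrite ler_pdivlMr// => h2; rewrite normrM; apply: le_trans h2.
rewrite ler_wpM2l// (le_trans (ler_normB _ _))//.
by have := c_le (x, a); have := inf_c; lra.
Unshelve. all: by end_near. Qed.

Let G f x a := expR (cost x a) * I f x a.

Let G_ge0 f x a : admissible f -> 0 <= G f x a.
Proof. by move=> af; rewrite mulr_ge0 ?expR_ge0 ?I_ge0. Qed.

Let expR_cost_le x a : expR (cost x a) <= expR C.
Proof. by rewrite ler_expR (le_trans (ler_norm _)). Qed.

Let expR_cost_ge x a : expR (- C) <= expR (cost x a).
Proof. by rewrite ler_expR; have := cost_le x a;
  rewrite ler_norml => /andP[]. Qed.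

Let T_leG f x a : admissible f -> T f x <= G f x a.
Proof. by move=> af; apply: (@inf_range_le _ _ _ 0) => a'; exact: G_ge0. Qed.

Let T_ge f x k : (forall a, k <= G f x a) -> k <= T f x.
Proof. by move=> h; apply: le_inf_range; [exact: point|exact: h]. Qed.

Let T_ge0 f x : admissible f -> 0 <= T f x.
Proof. by move=> af; apply: T_ge => a; exact: G_ge0. Qed.

Let T_cst1 x : expR (- C) <= T (cst 1) x.
Proof. by apply: T_ge => a; rewrite /G I_cst1 mulr1. Qed.

Let T_le f g (s t : R) : admissible f -> admissible g -> 0 <= s -> 0 <= t ->
  (forall y, Bn b n y -> f y <= s * g y + t) ->
  forall x, T f x <= s * T g x + t * expR C.
Proof.
move=> af ag s0 t0 fg x.
have h a : T f x - t * expR C <= s * G g x a.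
  rewrite lerBlDr (le_trans (T_leG x a af))// /G.
  rewrite (le_trans (ler_wpM2l (expR_ge0 _) (I_le x a af ag s0 t0 fg)))//.
  by rewrite mulrDr mulrCA lerD// mulrC ler_wpM2l.
rewrite -lerBlDr; move: s0; rewrite le_eqVlt => /predU1P[s0|s0].
  by move: (h point); rewrite -s0 !mul0r.
by rewrite -ler_pdivrMl//; apply: T_ge => a; rewrite ler_pdivrMl.
Qed.

Let G_near x (e : R) : 0 < e -> \forall y \near x, forall f a, admissible f ->
  (forall z, Bn b n z -> f z <= 1) -> `|G f y a - G f x a| <= e.
Proof.
move=> e0; pose r := Num.min 1 (e / (3 * expR C)).
have r0 : 0 < r by rewrite lt_min ltr01 divr_gt0// mulr_gt0// expR_gt0.
have r1 : r <= 1 by rewrite ge_min lexx.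
have re : 3 * r * expR C <= e.
  by rewrite mulrAC -ler_pdivlMl ?mulr_gt0 ?expR_gt0// mulrC ge_min lexx orbT.
have l0 : 0 < ln (1 + r) by rewrite ln_gt0// ltrDl.
have H1 := cost_near x l0.
have H2 := Ptilde_near mu b n U_compact P_variation_continuous x r0.
near=> y => f a af f1.
have h1 : forall a, `|cost y a - cost x a| <= ln (1 + r) by near: y.
have {}h1 := h1 a.
have h2 : forall a A, measurable A ->
  (Ptilde P mu b n y a A <= Ptilde P mu b n x a A + r%:E
   /\ Ptilde P mu b n x a A <= Ptilde P mu b n y a A + r%:E)%E by near: y;
     exact: H2.
(* The variation estimate needs values in [0, 1] everywhere, while [f] is at most 1 on [Bn b n]
   only; truncation does not change the means under [Ptilde]. *)
pose g z := Num.min (f z) 1.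
have g01 z : 0 <= g z <= 1 by rewrite /g le_min (af.2 z) ler01 ge_min lexx orbT.
have cg : continuous g.
  move=> z; apply: continuous_min; [exact: af.1.1|exact: cvg_cst].
have ag : admissible g.
  split; last by move=> z; case/andP: (g01 z).
  by split => //; exists 1 => z; have /andP[? ?] := g01 z; rewrite ger0_norm.
have Ifg z : I f z a = I g z a.
  apply/eqP; rewrite eq_le; apply/andP; split.
    rewrite -[leRHS]addr0 -[X in _ <= X + _]mul1r; apply: I_le => // w Bw.
    by rewrite mul1r addr0 /g le_min lexx f1.
  rewrite -[leRHS]addr0 -[X in _ <= X + _]mul1r; apply: I_le => // w Bw.
  by rewrite mul1r addr0 /g ge_min lexx.
have I1 z : I g z a <= 1.
  rewrite -[leRHS]add0r -(mul0r (I g z a)); apply: I_le => // w _.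
  by rewrite mul0r add0r; case/andP: (g01 w).
have Iyx : I g y a <= I g x a + r.
  by apply: I_variation => // A mA; exact: (h2 a A mA).1.
have Ixy : I g x a <= I g y a + r.
  by apply: I_variation => // A mA; exact: (h2 a A mA).2.
have key := fun p q J L =>
  @expR_mul_perturb R C r e p q J L r0 r1 re.
have I01 z : 0 <= I g z a <= 1 by rewrite I_ge0// I1.
have costC z : cost z a <= C by exact: le_trans (ler_norm _) (cost_le z a).
move: h1; rewrite ler_distl => /andP[l1 l2].
rewrite /G !Ifg ler_distl; apply/andP; split.
  by rewrite lerBlDr; apply: key => //; rewrite lerBlDl -lerBlDr.
by apply: key => //; rewrite lerBlDl.
Unshelve. all: by end_near. Qed.

Let T_near x (e : R) : 0 < e -> \forall y \near x, forall f, admissible f ->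
  (forall z, Bn b n z -> f z <= 1) -> `|T f y - T f x| <= e.
Proof.
move=> e0; move: (G_near x e0); apply: filterS => y h f af f1.
have {}h a : G f x a - e <= G f y a <= G f x a + e by rewrite -ler_distl h.
rewrite ler_distl; apply/andP; split; last rewrite -lerBlDr.
  apply: T_ge => a; have /andP[+ _] := h a; apply: le_trans.
  by rewrite lerD2r; exact: T_leG.
apply: T_ge => a; have /andP[_ +] := h a; rewrite lerBlDr; apply: le_trans.
exact: T_leG.
Qed.

Let eigenfunction_gt0 f kappa : admissible f -> `|kappa| <= C ->
  (exists2 x, Bn b n x & f x = 1) -> (forall x, Bn b n x -> f x <= 1) ->
  (forall x, T f x = expR kappa * f x) -> forall x, Bn b n x -> 0 < f x.
Proof.
move=> af kC [x1 Bx1 fx1] f1 Tf x Bx.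
have [[cf _] f0] := af.
pose O := [set y | 2^-1 < f y].
have oO : open O.
  rewrite (_ : O = f @^-1` `]2^-1, +oo[%classic).
    by apply: open_comp => [y _|]; [exact: cf|exact: interval_open].
  by apply/seteqP; split => y; rewrite /O /= in_itv/= andbT.
have OB : O `&` Bn b n !=set0 by exists x1; split => //; rewrite /O /= fx1; lra.
have [m m0 p0] := P_irreducible Bx oO OB.
set p := ereal_inf _ in p0.
(* One factor [expR (- C)] is below every [expR (cost x a)], the other absorbs the eigenvalue
   [expR kappa]. *)
pose delta := expR (- (C + C)).
have delta01 : 0 <= delta <= 1.
  by rewrite expR_ge0/= -expR0 ler_expR oppr_le0 addr_ge0.
(* A control within [e / 3] of the infimum at [y] stays within [e] of it nearby, as [G] and [T] each
   move by at most [e / 3]; then a finite selection applies. *)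
have excessive (e : R) : 0 < e -> exists2 u : E -> U, measurable_fun [set: borel E]
      ((fun x => (x, u x)) : borel E -> borel (E * U)%type) &
    forall y, Bn b n y ->
    (delta%:E * \int[P (y, u y)]_(z in Bn b n) (f z)%:E <= (f y + e)%:E)%E.
  move=> e0; have e3 : 0 < e / 3 by rewrite divr_gt0.
  have [|u [mu' uQ]] := measurable_feedback_selection (Q := fun a y => Bn b n y ->
    (delta%:E * \int[P (y, a)]_(z in Bn b n) (f z)%:E <= (f y + e)%:E)%E) Bn_compact.
    move=> y By.
    have hinf : has_inf [set G f y a | a in [set: U]].
      split; first by exists (G f y point), point.
      by exists 0 => _ [a _ <-]; exact: G_ge0.
    have [_ [a _ <-] Ga] := inf_adherent e3 hinf.
    have H1 := G_near y e3; have H2 := T_near y e3.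
    exists a; near=> z => Bz.
    have h1 : `|G f z a - G f y a| <= e / 3 by near: z;
      apply: filterS H1 => z; exact.
    have h2 : `|T f z - T f y| <= e / 3 by near: z; apply: filterS H2 => z;
      exact.
    have GT : G f z a <= T f z + e.
      apply: (@le_trans _ _ (G f y a + e / 3)).
        by move: h1; rewrite ler_distl => /andP[].
      rewrite (_ : T f z + e = T f z + e / 3 + e / 3 + e / 3); last by field.
      rewrite lerD2r ltW// (lt_le_trans Ga)// lerD2r.
      by move: h2; rewrite ler_distlC => /andP[_]; rewrite addrC.
    apply: (@le_trans _ _ (delta * I f z a)%:E); last first.
      rewrite lee_fin /delta opprD expRD -mulrA.
      apply: (@le_trans _ _ (expR (- C) * (T f z + e))).
        rewrite ler_wpM2l ?expR_ge0//; apply: le_trans GT.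
        by rewrite ler_wpM2r ?I_ge0.
      rewrite Tf mulrDr mulrA -expRD lerD//.
        rewrite ler_piMl// -expR0 ler_expR addrC subr_le0.
        exact: le_trans (ler_norm _) kC.
      by rewrite ler_piMl ?(ltW e0)// -expR0 ler_expR oppr_le0.
    rewrite EFinM -Ptilde_meanE//; apply: lee_wpmul2l.
      by rewrite lee_fin expR_ge0.
    have mf := admissible_measurable af; have mB := measurable_Bn b n.
    apply: (@le_trans _ _ (\int[Ptilde P mu b n z a]_(y in Bn b n) (f y)%:E)%E).
      apply: le_restr_integral => //.
      by move=> A mA AB; exact: Ptilde_ge.
    apply: ge0_subset_integral => //.
    by move=> w _; rewrite lee_fin.
  by exists u => // y By; exact: uQ.
have [q q0 qp] : exists2 q : R, 0 < q & (q%:E <= p)%E.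
  move: p0; case: p => [r r0||//]; first by exists r.
  by move=> _; exists 1 => //; rewrite leey.
(* The strategy depends on [e], but [m] and [q] do not, since [q] is below the infimum over all
   strategies. Hence [e] can be taken small afterwards. *)
have lower (e : R) : 0 < e -> delta ^+ m * 2^-1 * q <= f x + m%:R * e.
  move=> e0; have [u mu' uf] := excessive e e0.
  have [V Vu] := feedback_strategy P mu' m x.
  have mf : measurable_fun [set: borel E] f by exact: continuous_measurable_borel.
  have h := Phat_le_excessive mu' (measurable_Bn b n) mf f0 delta01 (ltW e0) uf Vu
    Bx erefl (_ : 0 <= 2^-1).
  rewrite -lee_fin; apply: le_trans (h _); last by rewrite invr_ge0.
  rewrite EFinM; apply: lee_wpmul2l.
    by rewrite lee_fin mulr_ge0 ?invr_ge0// exprn_ge0// expR_ge0.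
  by apply: (le_trans qp); apply: ereal_inf_lbound; exists V.
pose k := delta ^+ m * 2^-1 * q.
have k0 : 0 < k by rewrite !mulr_gt0 ?invr_gt0// exprn_gt0// expR_gt0.
have m0' : 0 < m%:R :> R by rewrite ltr0n.
(* With this [e] the accumulated error is half of [k]. *)
have := lower (k / 2 / m%:R).
rewrite !divr_gt0// => /(_ isT).
rewrite -/k [X in _ + X]mulrC divfK ?gt_eqF// [leLHS]splitr lerD2r;
  apply: lt_le_trans.
by rewrite divr_gt0.
Unshelve. all: by end_near. Qed.

Lemma bellman_eigenfunction : exists f kappa,
  [/\ admissible f, exists2 eta, 0 < eta & forall x, eta <= f x &
      forall x, T f x = expR kappa * f x].
Proof.
apply: (@nonlinear_Perron_Frobenius R E (Bn b n) T C) => //.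
by exists b; exact: Bn_center.
Qed.

End BellmanOperator.

(** * Normalization and the equation in exponential form *)

Lemma bounded_fun_le (T : Type) (R : realType) (f : T -> R) :
  bounded_fun f -> exists2 M, 0 < M & forall x, `|f x| <= M.
Proof.
move=> [M [_ fM]]; exists (Num.max 1 (M + 1)); first by rewrite lt_max ltr01.
by move=> x; apply: fM => //; rewrite lt_max ltrDl ltr01 orbT.
Qed.

Theorem theorem4p1 (R : realType) (E U : pmetricType R) (b : E)
    (E_locally_compact : locally_compact [set: E])
    (E_separable : separable E)
    (Bn_compact : forall n : nat, (0 < n)%N -> compact (Bn b n))
    (U_compact : compact [set: U])
    (P : R.-pker (borel (E * U)%type) ~> (borel E))
    (c : E * U -> R)
    (c_continuous : continuous c)
    (c_bounded : bounded_fun c)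
    (c_nonconstant : ~ exists k : R, forall z : E * U, c z = k)
    (cbar_ge0 : 0 <= sup (range c))
    (mu : probability (borel E) R)
    (mu_support : support_of mu `<=` Bn b 1)
    (P_variation_continuous : variation_continuous P)
    (P_irreducible : forall (n : nat) (x : E) (O : set E), (0 < n)%N ->
      Bn b n x -> open O -> O `&` Bn b n !=set0 ->
      exists2 m : nat, (0 < m)%N &
        (0 < ereal_inf [set p | exists V : strategy P m x,
                                  p = Phat b n V O])%E) :
  forall n : nat, (0 < n)%N ->
    exists (w : E -> R) (lambda : R),
      [/\ continuous w,
          bounded_fun w,
          forall x : E,
            (expR (w x))%:E =
            ereal_inf [set ((expR (cn b c n x a - lambda))%:E
                        * \int[Ptilde P mu b n x a]_y (expR (w y))%:E)%E
                      | a in [set: U]]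
        & sup [set w x | x in Bn b n.+1] = 0].
Proof.
move=> n n0; have [C _ cC] := bounded_fun_le c_bounded.
have mu_Bn : mu (~` Bn b n) = 0%E.
  have Bn_closed : closed (Bn b n).
    by apply: compact_closed; [exact: metric_hausdorff|exact: Bn_compact].
  apply: support_negligible => // x /mu_support /=.
  by rewrite /Bn/= => /le_trans; apply; rewrite ler_nat.
have [f [kappa [[[cf [M fM]] f0] [eta eta0 feta] Tf]]] :=
  bellman_eigenfunction (Bn_compact n n0) U_compact c_continuous cC mu_Bn
    P_variation_continuous (fun x O => @P_irreducible n x O n0).
have fgt0 x : 0 < f x by exact: lt_le_trans (feta x).
(* The eigenfunction was built on [Bn b n], but the normalization divides by its maximum over the
   larger ball [Bn b n.+1]. *)
have [xm /set_mem Bxm fxm] : exists2 y, y \in Bn b n.+1 &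
    forall t, t \in Bn b n.+1 -> f t <= f y.
  apply: compact_EVT_max; [by exists b; exact: Bn_center|exact: Bn_compact|].
  exact: continuous_subspaceT.
pose w x := ln (f x / f xm).
have wE x : expR (w x) = (f xm)^-1 * f x by rewrite lnK ?posrE ?divr_gt0// mulrC.
have bf : bounded_continuous f by split => //; exists M.
have cw : continuous w.
  move=> x; apply: (@continuous_comp _ _ _ (fun y => f y / f xm) (@ln R)).
    by apply: cvgM; [exact: cf|exact: cvg_cst].
  by apply: continuous_ln; rewrite divr_gt0.
exists w, kappa; split => //.
- have M0 : 0 < M by exact: lt_le_trans (fgt0 b) (le_trans (ler_norm _) (fM b)).
  exists (`|ln (eta / f xm)| + `|ln (M / f xm)|); split; first exact: num_real.
  move=> N /ltW hN x _; apply: le_trans hN; rewrite ler_norml; apply/andP;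
    split.
    rewrite lerNl (le_trans (_ : _ <= `|ln (eta / f xm)|))// ?lerDl//.
    rewrite lerNl; apply: le_trans (_ : ln (eta / f xm) <= _).
      by rewrite lerNl -normrN ler_norm.
    by rewrite ler_ln ?posrE ?divr_gt0// ler_pM2r ?invr_gt0.
  apply: (@le_trans _ _ (ln (M / f xm))).
    rewrite ler_ln ?posrE ?divr_gt0// ler_pM2r ?invr_gt0//.
    exact: le_trans (ler_norm _) (fM x).
  by rewrite (le_trans (ler_norm _))// lerDr.
- move=> x; rewrite wE.
  have meanE a : (\int[Ptilde P mu b n x a]_y (expR (w y))%:E =
      ((f xm)^-1 * Ptilde_mean P mu b n f x a)%:E)%E.
    under eq_integral do rewrite wE EFinM.
    rewrite ge0_integralZl//=; last 3 first.
    + by apply/measurable_EFinP; exact: continuous_measurable_borel.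
    + by move=> y _; rewrite lee_fin.
    + by rewrite lee_fin invr_ge0 ltW.
    by rewrite EFinM Ptilde_meanE.
  (* The extended-real infimum in the equation for [w] is [k] times the real infimum defining
     [bellman]. *)
  pose k := expR (- kappa) * (f xm)^-1.
  have k0 : 0 < k by rewrite mulr_gt0 ?expR_gt0 ?invr_gt0.
  rewrite (_ : [set _ | a in _] = [set (k%:E * y)%E | y in
    EFin @` [set expR (cn b c n x a) * Ptilde_mean P mu b n f x a | a in [set: U]]]).
    rewrite ereal_inf_pZl// ereal_inf_EFin; last 2 first.
    + exists 0 => _ [a _ <-]; rewrite mulr_ge0 ?expR_ge0// fine_ge0//.
      by apply: integral_ge0 => y _; rewrite lee_fin.
    + by exists (expR (cn b c n x point) * Ptilde_mean P mu b n f x point), point.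
    rewrite -[inf _]/(bellman P mu b c n f x) Tf -EFinM; congr EFin.
    by rewrite /k mulrACA -expRD addNr expR0 mul1r.
  rewrite !image_comp; apply: eq_imagel => a _ /=.
  by rewrite meanE -!EFinM; congr EFin; rewrite expRD /k; ring.
apply/eqP; rewrite eq_le; apply/andP; split.
  apply: sup_le_ub; first by exists (w xm), xm.
  move=> _ [y By <-]; rewrite -(ln1 R) ler_ln ?posrE ?divr_gt0//.
  by rewrite ler_pdivrMr// mul1r fxm//; exact: mem_set.
apply: sup_upper_bound; last by exists xm => //; rewrite /w divff ?gt_eqF// ln1.
split; first by exists (w xm), xm.
exists 0 => _ [y By <-]; rewrite -(ln1 R) ler_ln ?posrE ?divr_gt0//.
by rewrite ler_pdivrMr// mul1r fxm//; exact: mem_set.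
Qed.
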